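(* Let $d=2$ and let $0<t\le s\le 1$ with $s=t$ or $s=1$. Then there exists $f\in L_1[0,1]^2$ such that the sequence $(G_m^{s,t}(f))_{m\ge 1}$ of approximants produced by the $(s,t)$-weak greedy algorithm for the Haar system (defined in the context) does not converge in $L_1[0,1]^2$.
   Context: $L_1[0,1]^d$ is the space $L_1([0,1]^d)$ with Lebesgue measure $\mu$ and norm $\|f\|=\int|f|$; here $d=2$. Haar system. For $n\ge 0$ let $\mathcal D_n$ be the set of dyadic intervals $[k2^{-n},(k+1)2^{-n})$, $0\le k<2^n$; $\mathcal D_n^d=\mathcal D_n\times\cdots\times\mathcal D_n$ ($d$ factors) is the set of dyadic cubes of side length $2^{-n}$, and $\mathcal D^d=\bigcup_{n\ge 0}\mathcal D_n^d$. For $a<b$ put $r^{(0)}_{[a,b)}=\frac{\chi_{[a,b)}}{b-a}$ and $r^{(1)}_{[a,b)}=\frac{\chi_{[a,(a+b)/2)}-\chi_{[(a+b)/2,b)}}{b-a}$. For $I=I_1\times\cdots\times I_d\in\mathcal D^d$ and $1\le j\le 2^d-1$ with $j=\sum_{k=1}^d\epsilon_k2^{d-k}$, $\epsilon_k\in\{0,1\}$, put $h_I^{(j)}(x)=\prod_{k=1}^d r_{I_k}^{(\epsilon_k)}(x_k)$. The Haar system consists of all $h_I^{(j)}$ together with $\chi_{[0,1)^d}$. The Haar coefficients are $c_I^{(i)}(f)=\mu(I)\int_I f h_I^{(i)}$; the coefficient of $\chi_{[0,1)^d}$ is $\int f$. Order. For intervals, $[a,b)\prec[c,d)$ if $b-a>d-c$,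 or $b-a=d-c$ and $a<c$. For cubes $I=I_1\times\cdots\times I_d$ and $J=J_1\times\cdots\times J_d$ in $\mathcal D^d$, $I\prec J$ if for some $k$ one has $I_1=J_1,\dots,I_{k-1}=J_{k-1}$ and $I_k\prec J_k$. The $(s,t)$-weak greedy algorithm ($0<t\le s\le 1$). Put $G_0=G_0^{s,t}(f)=\left(\int f\right)\chi_{[0,1)^d}$ and $R_0=f-G_0$. For $m\ge 1$, if $R_{m-1}=0$ put $G_m=G_{m-1}$ and $R_m=0$; otherwise: 1) let $\Delta_m$ be the first cube in the order $\prec$, and then $j_m$ the smallest index in $\{1,\dots,2^d-1\}$, such that $|c_{\Delta_m}^{(j_m)}(R_{m-1})|=\max\{|c_I^{(i)}(R_{m-1})|: I\in\mathcal D^d,\ 1\le i\le 2^d-1\}$; 2) let $\tilde\Delta_m\supseteq\Delta_m$ be the largest dyadic cube containing $\Delta_m$ such that for every $I\in\mathcal D^d$ with $\Delta_m\subseteq I\subseteq\tilde\Delta_m$ there is $1\le i\le 2^d-1$ with $|c_I^{(i)}(R_{m-1})|\ge s|c_{\Delta_m}^{(j_m)}(R_{m-1})|$; 3) choose $1\le i_m\le 2^d-1$ for which $|c_{\tilde\Delta_m}^{(i_m)}(R_{m-1})|$ is the smallest value satisfying $|c_{\tilde\Delta_m}^{(i_m)}(R_{m-1})|\ge\frac ts\max_{1\le j\le 2^d-1}|c_{\tilde\Delta_m}^{(j)}(R_{m-1})|$; 4) put $G_m=G_m^{s,t}(f)=G_{m-1}+c_{\tilde\Delta_m}^{(i_m)}(f)\,h_{\tilde\Delta_m}^{(i_m)}$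 and $R_m=f-G_m$. *)

(* Defs.v *)
From HB Require Import structures.
From mathcomp Require Import all_boot all_order all_algebra.
From mathcomp Require Import all_classical all_reals all_analysis.

Set Implicit Arguments.
Unset Strict Implicit.
Unset Printing Implicit Defensive.

Import Order.TTheory GRing.Theory Num.Theory numFieldNormedType.Exports.

Local Open Scope classical_set_scope.
Local Open Scope ring_scope.

(* [L_1([0,1]^2)] is rendered by functions [f : R * R -> R] integrable on the
   closed unit square; elements are identified almost everywhere, so equality
   in [L_1] is [ae] equality and convergence is convergence of the integral of
   the absolute difference. *)

Notation leb2 R := (@lebesgue_measure R \x @lebesgue_measure R)%E.

Definition usquare (R : realType) : set (R * R) :=
  [set` `[0, 1]] `*` [set` `[0, 1]].

Definition inL1 (R : realType) (f : R * R -> R) : Prop :=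
  (leb2 R).-integrable (@usquare R) (EFin \o f).

(* The dyadic cube of level [n] and positions [k1, k2 < 2^n]. *)
Record dcube := DCube {
  level : nat;
  pos1 : 'I_(2 ^ level);
  pos2 : 'I_(2 ^ level) }.

Section Haar.
Context {R : realType}.
Implicit Types (f g : R * R -> R) (I J T D : dcube) (i j : nat).

(* A half-open interval [a, b[ is given by its pair of endpoints. *)
Definition dyad (n k : nat) : R * R := (k%:R / 2 ^+ n, k.+1%:R / 2 ^+ n).

Definition side1 I : R * R := dyad (level I) (pos1 I).
Definition side2 I : R * R := dyad (level I) (pos2 I).

Definition ico (A : R * R) : set R := [set` `[A.1, A.2[].

Definition cube_set I : set (R * R) := ico (side1 I) `*` ico (side2 I).

Definition rfun (e : bool) (A : R * R) (x : R) : R :=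
  let: (a, b) := A in
  (if e then \1_(ico (a, (a + b) / 2)) x - \1_(ico ((a + b) / 2, b)) x
   else \1_(ico (a, b)) x) / (b - a).

(* Here [j = 2 * e1 + e2] ranges over 1, 2, 3, so that [e1] and [e2] are the
   binary digits [odd j./2] and [odd j]. *)
Definition haar I j (x : R * R) : R :=
  rfun (odd j./2) (side1 I) x.1 * rfun (odd j) (side2 I) x.2.

Definition haar_index j : bool := (1 <= j <= 3)%N.

Definition coef I j f : R :=
  fine ((leb2 R) (cube_set I)) *
  \int[leb2 R]_(x in cube_set I) (f x * haar I j x).

Definition prec_itv (A B : R * R) : Prop :=
  let: (a, b) := A in let: (c, d) := B in
  d - c < b - a \/ (b - a = d - c /\ a < c).

Definition prec I J : Prop :=
  prec_itv (side1 I) (side1 J) \/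
  (side1 I = side1 J /\ prec_itv (side2 I) (side2 J)).

Definition max_coef (r : R * R -> R) I j : Prop :=
  haar_index j /\
  forall J i, haar_index i -> `|coef J i r| <= `|coef I j r|.

Definition first_max_coef (r : R * R -> R) D j : Prop :=
  [/\ max_coef r D j,
      forall I i, max_coef r I i -> I = D \/ prec D I
    & forall i, max_coef r D i -> (j <= i)%N].

Definition chain_cond (s : R) (r : R * R -> R) D j T : Prop :=
  cube_set D `<=` cube_set T /\
  forall I, cube_set D `<=` cube_set I -> cube_set I `<=` cube_set T ->
    exists2 i, haar_index i & s * `|coef D j r| <= `|coef I i r|.

Definition largest_chain (s : R) (r : R * R -> R) D j T : Prop :=
  chain_cond s r D j T /\
  forall J, chain_cond s r D j J -> cube_set J `<=` cube_set T.

Definition admissible_index (s t : R) (r : R * R -> R) T i : Prop :=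
  haar_index i /\
  t / s * \big[Order.max/0]_(1 <= j < 4) `|coef T j r| <= `|coef T i r|.

Definition smallest_admissible (s t : R) (r : R * R -> R) T i : Prop :=
  admissible_index s t r T i /\
  forall j, admissible_index s t r T j -> `|coef T i r| <= `|coef T j r|.

(* One step, from [G] (approximant m-1) to [G'] (approximant m).  It is a
   relation because two indices [i] may realise the smallest admissible
   modulus.  The residual is always [f - G], which is a representative of the
   zero class of [L_1] once the algorithm has stopped. *)
Definition wga_step (s t : R) f G G' : Prop :=
  let r := f \- G in
  let r_null := {ae leb2 R, forall x, usquare x -> r x = 0} in
  (r_null -> forall x, G' x = G x) /\
  (~ r_null ->
   exists D j T i,
     [/\ first_max_coef r D j,
         largest_chain s r D j T,
         smallest_admissible s t r T i
       & forall x, G' x = G x + coef T i f * haar T i x]).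

(* [G] is a sequence of approximants which the (s, t)-weak greedy algorithm
   can produce from [f]. *)
Definition wga_run (s t : R) f (G : nat -> R * R -> R) : Prop :=
  (forall x, G 0%N x =
     (\int[leb2 R]_(y in @usquare R) f y) * \1_(ico (0, 1) `*` ico (0, 1)) x) /\
  forall m, wga_step s t f (G m) (G m.+1).

Definition cvg_L1 (G : nat -> R * R -> R) g : Prop :=
  (fun m => \int[leb2 R]_(x in @usquare R) `|G m x - g x|%:E)%E @ \oo
    --> 0%E.

End Haar.

(* Main.v *)
Require Import Defs.
From HB Require Import structures.
From mathcomp Require Import all_boot all_order all_algebra.
From mathcomp Require Import all_classical all_reals all_analysis.
From mathcomp Require Import measurable_realfun.
From mathcomp Require Import ring lra zify.

Set Implicit Arguments.
Unset Strict Implicit.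
Unset Printing Implicit Defensive.

Import Order.TTheory GRing.Theory Num.Theory numFieldNormedType.Exports.

Local Open Scope classical_set_scope.
Local Open Scope ring_scope.

(** The counterexample has all its nonconstant Haar coefficients on the corner
branch [Q k] = [0, 2^-k)^2.  A function that is constant on each of the three
children of [Q k] other than [Q k.+1], for all [k], is determined off the origin
by its integrals over these cells; if the integrals are absolutely summable, the
function is integrable ([exists_cellular]), and the coefficients at level [k] are
signed sums of the three integrals and of the mass of [Q k.+1] ([coef_corner]).
When these integrals are small along many levels, so that the mass stays nearly
constant, all three coefficients at each level are close to it, while the L1 norm
stays bounded: the sum nearly telescopes to a multiple of the normalised indicator
of a small cube.  Such a cancellation is lost if the algorithm takes only part of
these coefficients.  The partial sum then has an L1 norm proportional to the number
of levels, because each level contributes a fixed amount on one cell of its own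
([haar_sum_norm_ge]).

Levels are grouped into blocks; in block [p], which has about [b^(p+1)] levels,
all coefficients are of size [b^-p].  As [b] is large compared with [1 / t^2],
every coefficient of a block is more than [1 / t] times larger than those of the
later blocks, so the algorithm exhausts the blocks one after the other
([stage_full_levels]).  In every block, the terms of that block selected up to
a suitable time have a sum of norm at least [t / 16] ([base_diverges]); hence the
approximants are not a Cauchy sequence ([run_not_cvg]).

The part of the block that is taken first depends on the parameters.
- If [s = t], the coefficient of index 1 is [t] times the amplitude of the
  block, those of indices 2 and 3 are slightly smaller, and the last level of the
  block carries a coefficient equal to the amplitude.  This one is maximal;
  the chain of cubes above it reaches the top of the block, then descends one level
  at a time because, once its first coefficient has been removed, a level no
  longer meets the threshold.  So all the coefficients of index 1 are removed
  before any other one of the block ([column_forced]).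
- If [s = 1], no chain is longer than its first cube.  The mass oscillates
  slightly, so that the coefficients at even levels exceed those at odd levels,
  and the even levels are exhausted first ([even_levels_forced]). *)

(** * Dyadic boxes and the values of Haar functions *)
Section Boxes.
Context {R : realType}.
Implicit Types (n k : nat) (a b : bool) (x : R * R) (j : nat).
Notation plane := (measurableTypeR R * measurableTypeR R)%type.

Definition box n k1 k2 : set (R * R) := ico (dyad n k1) `*` ico (dyad n k2).

(** The sign of the Haar function of index [j] on the child [(a, b)] of its cube. *)
Definition sgn j a b : R := (-1) ^+ (odd j./2 && a) * (-1) ^+ (odd j && b).

Lemma in_dyadE n k (y : R) :
  ico (dyad n k) y <-> k%:R <= y * 2 ^+ n < k%:R + 1.
Proof.
have p : (0 : R) < 2 ^+ n by rewrite exprn_gt0.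
by rewrite /ico /dyad /= in_itv /= ler_pdivrMr // ltr_pdivlMr // -[k.+1%:R]natr1; split.
Qed.

Lemma in_dyad_half n k a (y : R) :
  ico (dyad n.+1 (k.*2 + a)) y <->
  k.*2%:R + a%:R <= y * 2 ^+ n * 2 < k.*2%:R + a%:R + 1.
Proof. by rewrite in_dyadE exprSr mulrA natrD. Qed.

Lemma dyad_half_sub n k a : ico (dyad n.+1 (k.*2 + a)) `<=` ico (@dyad R n k).
Proof.
move=> y /in_dyad_half; rewrite in_dyadE -muln2 natrM.
by case: a => /= /andP[h1 h2]; apply/andP; split; lra.
Qed.

Lemma dyad_split n k (y : R) :
  ico (dyad n k) y -> exists a, ico (dyad n.+1 (k.*2 + a)) y.
Proof.
rewrite in_dyadE => /andP[h1 h2].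
have [h|h] := leP (k.*2%:R + 1) (y * 2 ^+ n * 2);
  [exists true | exists false]; apply/in_dyad_half;
  move: h; rewrite -muln2 natrM /= => h; apply/andP; split; lra.
Qed.

Lemma dyad_inj n k k' (y : R) :
  ico (dyad n k) y -> ico (dyad n k') y -> k = k'.
Proof.
rewrite !in_dyadE => /andP[h1 h2] /andP[h3 h4].
apply/eqP; rewrite eqn_leq; apply/andP; split; rewrite -ltnS -(ltr_nat R) -[_.+1%:R]natr1.
  exact: le_lt_trans h1 h4.
exact: le_lt_trans h3 h2.
Qed.

(** The two halves of a dyadic interval, as they appear in [rfun], are dyadic
intervals of the next level. *)
Lemma dyad_points n k :
  [/\ (k%:R / 2 ^+ n + k.+1%:R / 2 ^+ n) / 2 = (k.*2.+1)%:R / 2 ^+ n.+1 :> R,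
      k%:R / 2 ^+ n = (k.*2)%:R / 2 ^+ n.+1 :> R
    & k.+1%:R / 2 ^+ n = (k.*2.+2)%:R / 2 ^+ n.+1 :> R].
Proof.
have p0 : (2 : R) ^+ n != 0 by rewrite expf_neq0.
split.
- rewrite exprS -[k.*2.+1%:R]natr1 -[k.+1%:R]natr1 -muln2 natrM; field.
  by rewrite ?pnatr_eq0 ?p0.
- by rewrite exprS -muln2 natrM; field; rewrite ?pnatr_eq0 ?p0.
- by rewrite -doubleS exprS -muln2 natrM; field; rewrite ?pnatr_eq0 ?p0.
Qed.

Lemma rfun_half e n k a (y : R) : ico (dyad n.+1 (k.*2 + a)) y ->
  rfun e (dyad n k) y = 2 ^+ n * (-1) ^+ (e && a).
Proof.
move=> h; have p : (0 : R) < 2 ^+ n by rewrite exprn_gt0.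
have p0 : (2 : R) ^+ n != 0 by rewrite gt_eqF.
have [mid lft rgt] := dyad_points n k.
have len : k.+1%:R / 2 ^+ n - k%:R / 2 ^+ n = (2 ^+ n)^-1 :> R.
  by rewrite -[k.+1%:R]natr1; field.
have hi : ico (dyad n k) y by exact: dyad_half_sub h.
rewrite /rfun /dyad len invrK mulrC; congr (_ * _).
case: e => /=; last by rewrite indicE mem_set.
rewrite mid lft rgt.
have -> : (\1_(ico ((k.*2)%:R / 2 ^+ n.+1, (k.*2.+1)%:R / 2 ^+ n.+1)) y : R)
   = (~~ a)%:R.
  rewrite indicE; congr (nat_of_bool _)%:R; case: a h => h /=.
    apply/negbTE; rewrite notin_setE => h'.
    by have := dyad_inj h h'; lia.
  by rewrite mem_set //; rewrite addn0 in h.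
have -> : (\1_(ico ((k.*2.+1)%:R / 2 ^+ n.+1, (k.*2.+2)%:R / 2 ^+ n.+1)) y : R)
   = a%:R.
  rewrite indicE; congr (nat_of_bool _)%:R; case: a h => h /=.
    by rewrite mem_set //; rewrite addn1 in h.
  apply/negbTE; rewrite notin_setE => h'.
  by have := dyad_inj h h'; lia.
by case: (a); rewrite /= ?subr0 ?sub0r ?expr1 ?expr0.
Qed.

Lemma rfun_out e n k (y : R) : ~ ico (dyad n k) y -> rfun e (dyad n k) y = 0.
Proof.
move=> h.
have no a : ~ ico (dyad n.+1 (k.*2 + a)) y by move/dyad_half_sub.
have [mid lft rgt] := dyad_points n k.
rewrite /rfun /dyad; case: e; last by rewrite indicE memNset // mul0r.
rewrite mid lft rgt !indicE !memNset ?subrr ?mul0r //.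
  by have := no true; rewrite addn1.
by have := no false; rewrite addn0.
Qed.

Lemma box_child_sub n k1 k2 a b :
  box n.+1 (k1.*2 + a) (k2.*2 + b) `<=` box n k1 k2.
Proof. by move=> x [h1 h2]; split; apply: dyad_half_sub; eassumption. Qed.

Lemma box_split n k1 k2 x : box n k1 k2 x ->
  exists a b, box n.+1 (k1.*2 + a) (k2.*2 + b) x.
Proof.
by move=> [/dyad_split [a ha] /dyad_split [b hb]]; exists a, b; split.
Qed.

Lemma box_inj n k1 k2 l1 l2 x :
  box n k1 k2 x -> box n l1 l2 x -> k1 = l1 /\ k2 = l2.
Proof. by move=> [h1 h2] [h3 h4]; rewrite (dyad_inj h1 h3) (dyad_inj h2 h4). Qed.

Lemma haar_child I j a b x :
  box (level I).+1 ((pos1 I).*2 + a) ((pos2 I).*2 + b) x ->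
  haar I j x = 4 ^+ level I * sgn j a b.
Proof.
move=> [h1 h2]; rewrite /haar /side1 /side2 (rfun_half _ h1) (rfun_half _ h2).
have -> : (4 : R) = 2 * 2 by ring.
by rewrite exprMn /sgn; ring.
Qed.

Lemma haar_out I j x : ~ cube_set I x -> haar I j x = 0.
Proof.
move=> h; rewrite /haar.
have [h1|h1] := pselect (ico (side1 I) x.1); last by rewrite rfun_out // mul0r.
have [h2|h2] := pselect (ico (side2 I) x.2); last by rewrite (rfun_out _ h2) mulr0.
by case: h.
Qed.

Lemma measurable_ico (A : R * R) : measurable (ico A : set (measurableTypeR R)).
Proof. exact: measurable_itv. Qed.

Lemma measurable_box n k1 k2 : measurable (box n k1 k2 : set plane).
Proof. by apply: measurableX; apply: measurable_ico. Qed.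

Lemma leb_dyad n k : @lebesgue_measure R (ico (dyad n k)) = ((2 ^+ n)^-1)%:E.
Proof.
have p : (0 : R) < 2 ^+ n by rewrite exprn_gt0.
rewrite /ico lebesgue_measure_itv /= lte_fin ltr_pM2r ?invr_gt0 // ltr_nat ltnS leqnn.
by rewrite -EFinD -[k.+1%:R]natr1; congr (_%:E); field; rewrite gt_eqF.
Qed.

Lemma leb_box n k1 k2 : leb2 R (box n k1 k2) = ((4 ^+ n)^-1)%:E.
Proof.
rewrite /box product_measure1E; try exact: measurable_ico.
rewrite [X in (X * _)%E]leb_dyad [X in (_ * X)%E]leb_dyad -EFinM -invfM -exprMn.
by congr ((_ ^+ _)^-1)%:E; ring.
Qed.

Lemma measurable_usquare : measurable (@usquare R : set plane).
Proof. by apply: measurableX; apply: measurable_itv. Qed.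

Lemma leb_usquare : leb2 R (@usquare R) = 1%E.
Proof.
rewrite /usquare product_measure1E; try exact: measurable_itv.
have e : @lebesgue_measure R [set` `[0, 1]] = 1%E.
  by rewrite lebesgue_measure_itv /= lte_fin ltr01 oppr0 adde0.
by rewrite [X in (X * _)%E]e [X in (_ * X)%E]e mule1.
Qed.

Lemma box_usquare n k1 k2 : (k1 < 2 ^ n)%N -> (k2 < 2 ^ n)%N ->
  box n k1 k2 `<=` @usquare R.
Proof.
move=> l1 l2 [x y] [/= h1 h2].
have p : (0 : R) < 2 ^+ n by rewrite exprn_gt0.
have aux k (z : R) : (k < 2 ^ n)%N -> ico (dyad n k) z -> [set` `[0, 1]] z.
  move=> l /in_dyadE /andP[u v]; rewrite /= in_itv /=; apply/andP; split.
    by rewrite -(pmulr_lge0 _ p); exact: le_trans u.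
  rewrite -(ler_pM2r p) mul1r; apply: (le_trans (ltW v)).
  by rewrite natr1 -natrX ler_nat.
by split; [exact: aux l1 h1 | exact: aux l2 h2].
Qed.

Lemma cube_usquare I : cube_set I `<=` @usquare R.
Proof. by apply: box_usquare; apply: ltn_ord. Qed.

Lemma measurable_cube I : measurable (@cube_set R I : set plane).
Proof. exact: measurable_box. Qed.

End Boxes.

(** * Haar coefficients as signed sums of integrals *)
Section Integrals.
Context {R : realType}.
Implicit Types (n k : nat) (a b : bool) (x : R * R) (j : nat) (f g : R * R -> R).
Notation mu := (leb2 R).
Notation plane := (measurableTypeR R * measurableTypeR R)%type.

(** Sums over the four children of a cube. *)
Definition sum4 (F : bool -> bool -> R) : R :=
  F false false + F false true + F true false + F true true.

Lemma eq_sum4 F G : (forall a b, F a b = G a b) -> sum4 F = sum4 G.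
Proof. by move=> e; rewrite /sum4 !e. Qed.

Lemma sum4Z c F : sum4 (fun a b => c * F a b) = c * sum4 F.
Proof. by rewrite /sum4; ring. Qed.

Lemma sum4D F G : sum4 (fun a b => F a b + G a b) = sum4 F + sum4 G.
Proof. by rewrite /sum4; ring. Qed.

Lemma inL1D f g : inL1 f -> inL1 g -> inL1 (fun x => f x + g x).
Proof. by move=> hf hg; exact: (integrableD measurable_usquare hf hg). Qed.

Lemma inL1Z (c : R) f : inL1 f -> inL1 (fun x => c * f x).
Proof. by move=> hf; exact: (integrableZl measurable_usquare c hf). Qed.

Lemma inL1B f g : inL1 f -> inL1 g -> inL1 (fun x => f x - g x).
Proof.
move=> hf hg; have := inL1D hf (inL1Z (-1) hg).
by under eq_fun do rewrite mulN1r.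
Qed.

Lemma inL1_sum (I : Type) (s : seq I) (F : I -> R * R -> R) :
  (forall i, inL1 (F i)) -> inL1 (fun x => \sum_(i <- s) F i x).
Proof.
move=> h; elim: s => [|i s IH].
  under eq_fun do rewrite big_nil.
  exact: integrable0.
under eq_fun do rewrite big_cons.
exact: inL1D.
Qed.

Lemma integral_inL1_sum (I : Type) (u : seq I) (F : I -> R * R -> R) :
  (forall i : I, inL1 (F i)) ->
  \int[mu]_(x in @usquare R) (\sum_(i <- u) F i x) =
  \sum_(i <- u) \int[mu]_(x in @usquare R) F i x.
Proof.
move=> h; elim: u => [|i u IH].
  by rewrite big_nil; under eq_Rintegral do rewrite big_nil; rewrite /Rintegral integral0.
rewrite big_cons -IH -RintegralD; [|exact: measurable_usquare|exact: h|exact: inL1_sum].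
by under eq_Rintegral do rewrite big_cons.
Qed.

Lemma inL1_indic (A : set plane) : measurable A -> inL1 (\1_A : R * R -> R).
Proof.
move=> mA; apply: measurable_bounded_integrable.
- exact: measurable_usquare.
- by rewrite [X in (X < _)%E]leb_usquare ltry.
- exact: measurable_indic.
- exists 1; split => // M M1 x _ /=.
  by rewrite indicE (le_trans _ (ltW M1)) // normr_nat lern1 leq_b1.
Qed.

Lemma haarE I j x : haar I j x =
  sum4 (fun a b => 4 ^+ level I * sgn j a b *
    \1_(box (level I).+1 ((pos1 I).*2 + a) ((pos2 I).*2 + b)) x).
Proof.
have [h|h] := pselect (cube_set I x); last first.
  rewrite haar_out // /sum4 !indicE !memNset ?mulr0 ?addr0 //;
  by move=> /box_child_sub.
have [a [b hab]] := box_split h.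
rewrite (haar_child _ hab).
have E a' b' : (\1_(box (level I).+1 ((pos1 I).*2 + a') ((pos2 I).*2 + b')) x : R)
    = ((a' == a) && (b' == b))%:R.
  rewrite indicE; congr (nat_of_bool _)%:R; apply/idP/andP => [|[/eqP-> /eqP->]].
    by move/set_mem => /(box_inj hab); lia.
  exact: mem_set.
by rewrite /sum4 !E; case: (a); case: (b) => /=; ring.
Qed.

Lemma inL1_haar I j : inL1 (@haar R I j).
Proof.
have -> : @haar R I j = (fun x => haar I j x) by [].
under eq_fun do rewrite haarE.
rewrite /sum4; repeat (apply: inL1D); apply: inL1Z; apply: inL1_indic;
  exact: measurable_box.
Qed.

Lemma inL1S (A : set plane) f : measurable A -> A `<=` @usquare R ->
  inL1 f -> mu.-integrable A (EFin \o f).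
Proof. by move=> mA sA; apply: integrableS => //; exact: measurable_usquare. Qed.

Lemma integral_box4 n k1 k2 f : mu.-integrable (box n k1 k2) (EFin \o f) ->
  \int[mu]_(x in box n k1 k2) f x =
  sum4 (fun a b => \int[mu]_(x in box n.+1 (k1.*2 + a) (k2.*2 + b)) f x).
Proof.
move=> hf; pose c a b := @box R n.+1 (k1.*2 + a) (k2.*2 + b).
have mc a b : measurable (c a b : set plane) by exact: measurable_box.
have inj a b a' b' x : c a b x -> c a' b' x -> (a == a') && (b == b').
  by move=> h1 h2; have [e1 e2] := box_inj h1 h2; lia.
have e : box n k1 k2 = (c false false `|` c false true) `|` (c true false `|` c true true).
  apply/seteqP; split => x.
    move=> /box_split [a [b h]]; case: a h; case: b => h;
      [right; right|right; left|left; right|left; left]; exact: h.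
  by move=> [[]|[]] /box_child_sub.
have sub (A : set plane) : measurable A -> A `<=` box n k1 k2 -> mu.-integrable A (EFin \o f).
  by move=> mA sA; apply: integrableS hf => //; exact: measurable_box.
rewrite {1}e Rintegral_setU; last 4 first.
- exact: measurableU.
- exact: measurableU.
- by rewrite -e.
- by apply/disj_setPS => x [[h|h] [h'|h']]; have := inj _ _ _ _ _ h h'.
rewrite Rintegral_setU //; last 2 first.
- by apply: sub; [exact: measurableU | rewrite e; exact: subsetUl].
- by apply/disj_setPS => x [h h']; have := inj _ _ _ _ _ h h'.
rewrite Rintegral_setU //; last 2 first.
- by apply: sub; [exact: measurableU | rewrite e; exact: subsetUr].
- by apply/disj_setPS => x [h h']; have := inj _ _ _ _ _ h h'.
by rewrite addrA.
Qed.

Lemma haar_bound I j x : `|haar I j x| <= 4 ^+ level I.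
Proof.
have [h|h] := pselect (cube_set I x); last first.
  by rewrite haar_out // normr0 exprn_ge0.
have [a [b hab]] := box_split h.
by rewrite (haar_child _ hab) /sgn !normrM !normr_sign !mulr1 ger0_norm ?exprn_ge0.
Qed.

(** The Haar function is constant on each child, with absolute value the inverse
of the area of the cube: the factor [mu I] in the coefficient cancels it. *)
Lemma coef_sum4 I j f : inL1 f ->
  coef I j f = sum4 (fun a b => sgn j a b *
   \int[mu]_(x in box (level I).+1 ((pos1 I).*2 + a) ((pos2 I).*2 + b)) f x).
Proof.
move=> hf.
have p : (0 : R) < 4 ^+ level I by rewrite exprn_gt0.
have hc a b : mu.-integrable (box (level I).+1 ((pos1 I).*2 + a) ((pos2 I).*2 + b))
    (EFin \o f).
  apply: inL1S hf; first exact: measurable_box.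
  by move=> x /box_child_sub; exact: cube_usquare.
have mh : measurable_fun (cube_set I) (haar I j : plane -> R).
  apply/measurable_EFinP; apply: measurable_int (_ : mu.-integrable _ _).
  apply: inL1S (inL1_haar I j); [exact: measurable_cube | exact: cube_usquare].
have hI : mu.-integrable (cube_set I) (EFin \o f).
  by apply: inL1S hf; [exact: measurable_cube | exact: cube_usquare].
rewrite /coef [X in fine X](@leb_box R) integral_box4 /=; last first.
  have hZ := integrableZl (measurable_cube I) (4 ^+ level I) hI.
  apply: (le_integrable (measurable_cube I) _ _ hZ).
    apply/measurable_EFinP; apply: measurable_funM => //.
    by apply/measurable_EFinP; exact: measurable_int hI.
  move=> x _ /=; rewrite lee_fin [leLHS]normrM [leRHS]normrM mulrC.
  by apply: ler_wpM2r => //; apply: le_trans (haar_bound _ _ _) (ler_norm _).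
have E a b : \int[mu]_(x in box (level I).+1 ((pos1 I).*2 + a) ((pos2 I).*2 + b))
    (f x * haar I j x) = 4 ^+ level I * sgn j a b *
   \int[mu]_(x in box (level I).+1 ((pos1 I).*2 + a) ((pos2 I).*2 + b)) f x.
  rewrite -RintegralZl; [|exact: measurable_box|exact: hc].
  apply: eq_Rintegral => x /set_mem h.
  by rewrite (haar_child _ h) mulrC.
rewrite (_ : sum4 _ = sum4 (fun a b => 4 ^+ level I * (sgn j a b *
  \int[mu]_(x in box (level I).+1 ((pos1 I).*2 + a) ((pos2 I).*2 + b)) f x))).
  by rewrite sum4Z mulKf // gt_eqF.
by apply: eq_sum4 => a b; rewrite E mulrA.
Qed.

Lemma haar_coefD I j f g : inL1 f -> inL1 g ->
  coef I j (fun x => f x + g x) = coef I j f + coef I j g.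
Proof.
move=> hf hg; rewrite !coef_sum4 //; last exact: inL1D.
have E a b : \int[mu]_(x in box (level I).+1 ((pos1 I).*2 + a) ((pos2 I).*2 + b))
    (f x + g x) =
   \int[mu]_(x in box (level I).+1 ((pos1 I).*2 + a) ((pos2 I).*2 + b)) f x +
   \int[mu]_(x in box (level I).+1 ((pos1 I).*2 + a) ((pos2 I).*2 + b)) g x.
  have s : box (level I).+1 ((pos1 I).*2 + a) ((pos2 I).*2 + b) `<=` @usquare R.
    by move=> x /box_child_sub; exact: cube_usquare.
  by apply: RintegralD; [|apply: inL1S|apply: inL1S] => //; exact: measurable_box.
by rewrite -sum4D; apply: eq_sum4 => a b; rewrite E mulrDr.
Qed.

Lemma haar_coefZ I j (c : R) f : inL1 f ->
  coef I j (fun x => c * f x) = c * coef I j f.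
Proof.
move=> hf; rewrite !coef_sum4 //; last exact: inL1Z.
have E a b : \int[mu]_(x in box (level I).+1 ((pos1 I).*2 + a) ((pos2 I).*2 + b))
    (c * f x) =
   c * \int[mu]_(x in box (level I).+1 ((pos1 I).*2 + a) ((pos2 I).*2 + b)) f x.
  have s : box (level I).+1 ((pos1 I).*2 + a) ((pos2 I).*2 + b) `<=` @usquare R.
    by move=> x /box_child_sub; exact: cube_usquare.
  by apply: RintegralZl; [|apply: inL1S] => //; exact: measurable_box.
by rewrite -sum4Z; apply: eq_sum4 => a b; rewrite E mulrCA.
Qed.

Lemma haar_coefB I j f g : inL1 f -> inL1 g ->
  coef I j (fun x => f x - g x) = coef I j f - coef I j g.
Proof.
move=> hf hg; under eq_fun do rewrite -mulN1r.
by rewrite haar_coefD ?haar_coefZ ?mulN1r //; exact: inL1Z.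
Qed.

(** Guarantees that the algorithm has not stopped as long as some coefficient of
the residual is nonzero. *)
Lemma coef_null I j f : inL1 f ->
  {ae mu, forall x, usquare x -> f x = 0} -> coef I j f = 0.
Proof.
move=> hf f0; rewrite coef_sum4 //.
have E a b : \int[mu]_(x in box (level I).+1 ((pos1 I).*2 + a) ((pos2 I).*2 + b))
    f x = 0.
  have s : box (level I).+1 ((pos1 I).*2 + a) ((pos2 I).*2 + b) `<=` @usquare R.
    by move=> x /box_child_sub; exact: cube_usquare.
  have m := @measurable_box R (level I).+1 ((pos1 I).*2 + a) ((pos2 I).*2 + b).
  rewrite /Rintegral (@ae_eq_integral _ _ _ mu _ (cst 0%E)) //.
  - by rewrite integral0.
  - by apply: measurable_int (_ : mu.-integrable _ _); exact: inL1S hf.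
  - apply: (@filterS _ _ (ae_filter_ringOfSetsType mu) _ _ _ f0) => x h /s u /=.
    by rewrite h.
transitivity (sum4 (fun _ _ => 0 * 0)); last by rewrite sum4Z mul0r.
by apply: eq_sum4 => a b; rewrite E mulr0 mul0r.
Qed.

End Integrals.

(** * Functions that are constant on the cells of the corner branch *)
Section Cells.
Context {R : realType}.
Implicit Types (n k l : nat) (a b : bool) (x : R * R) (j : nat) (f g : R * R -> R).
Implicit Types (w : nat -> bool -> bool -> R) (m : nat -> R).
Notation mu := (leb2 R).
Notation plane := (measurableTypeR R * measurableTypeR R)%type.

(** Sums over the three children of a corner cube that are not corner cubes. *)
Definition sum3 (F : bool -> bool -> R) : R :=
  F false true + F true false + F true true.

Lemma sum4E F : sum4 F = F false false + sum3 F.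
Proof. by rewrite /sum4 /sum3 !addrA. Qed.

Lemma corner_ltn k : (0 < 2 ^ k)%N. Proof. by rewrite expn_gt0. Qed.

Definition Q k : dcube := DCube (Ordinal (corner_ltn k)) (Ordinal (corner_ltn k)).

Definition corner (I : dcube) : bool :=
  (nat_of_ord (pos1 I) == 0%N) && (nat_of_ord (pos2 I) == 0%N).

Lemma cornerE I : corner I -> I = Q (level I).
Proof.
case: I => n k1 k2 /andP[/= /eqP e1 /eqP e2].
by congr DCube; apply: val_inj.
Qed.

(** The weight [w k a b] is the integral over the cell, not the value there:
weights are what the coefficients and the L1 norm depend on. *)
Definition cellular g w := forall k a b, a || b ->
  forall x, box k.+1 a b x -> g x = 4 ^+ k.+1 * w k a b.

Lemma corner_sub k l : (k <= l)%N -> box l 0 0 `<=` @box R k 0 0.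
Proof.
move=> /subnK <-; elim: (l - k)%N => [|i IH] //; rewrite addSn.
by move=> x h; apply/IH/(@box_child_sub _ _ 0 0 false false).
Qed.

Lemma cell_sub k a b : box k.+1 a b `<=` @box R k 0 0.
Proof. exact: (@box_child_sub _ _ 0 0 a b). Qed.

Lemma cell_usquare k a b : box k.+1 a b `<=` @usquare R.
Proof. by move=> x h; apply: (@cube_usquare _ (Q k)); exact: cell_sub h. Qed.

Lemma cell_inj k l a b a' b' x : a || b -> a' || b' ->
  box k.+1 a b x -> box l.+1 a' b' x -> [/\ k = l, a = a' & b = b'].
Proof.
have aux k' l' (c d c' d' : bool) : c || d -> (k' < l')%N -> box k'.+1 c d x -> ~ box l'.+1 c' d' x.
  move=> cd kl h h1; have h2 := cell_sub h1.
  have h' := corner_sub kl h2.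
  by have [] := box_inj h h'; case: c cd {h} => //; case: d.
move=> ab ab' h h'; case: (ltngtP k l) => kl.
- by have := aux _ _ _ _ _ _ ab kl h h'.
- by have := aux _ _ _ _ _ _ ab' kl h' h.
- by subst l; have [] := box_inj h h'; split; lia.
Qed.

Lemma integral_cst_box n k1 k2 g (v : R) : (forall x, box n k1 k2 x -> g x = v) ->
  \int[mu]_(x in box n k1 k2) g x = v / 4 ^+ n.
Proof.
move=> e; rewrite (@eq_Rintegral _ _ _ _ _ (cst v)); last by move=> x /set_mem /e.
by rewrite Rintegral_cst ?[X in fine X]leb_box //; exact: measurable_box.
Qed.

Lemma integral_cell g w k a b : cellular g w -> a || b ->
  \int[mu]_(x in box k.+1 a b) g x = w k a b.
Proof.
by move=> cg ab; rewrite (integral_cst_box (cg _ _ _ ab)) mulrC mulKf.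
Qed.

(** Dominated convergence, the corner cubes shrinking to a null set. *)
Lemma integral_corner_cvg g : inL1 g ->
  (\int[mu]_(x in box k 0 0) g x) @[k --> \oo] --> (0 : R).
Proof.
move=> hg.
have mb n : measurable (box n 0 0 : set plane) by exact: measurable_box.
pose N : set plane := \bigcap_n box n 0 0.
have mN : measurable N by exact: bigcapT_measurable.
have N0 : mu N = 0%E.
  apply/eqP; rewrite eq_le measure_ge0 andbT; apply/lee_addgt0Pr => e e0.
  rewrite add0e.
  have [n ne] : exists n, (4 ^+ n)^-1 < e.
    have c0 : (fun n => (4 ^+ n)^-1 : R) @ \oo --> (0 : R).
      under eq_fun do rewrite -exprVn.
      by apply: cvg_expr; rewrite ger0_norm ?invr_ge0 // invf_lt1 // ltr1n.
    have := cvgr_lt 0 c0 e e0; case=> n _ /(_ n (leqnn n)) h; by exists n.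
  apply: (@le_trans _ _ (mu (box n 0 0))).
    by apply: le_measure; rewrite ?inE //; exact: bigcap_inf.
  by rewrite [leLHS]leb_box lee_fin ltW.
have su n : @usquare R `&` box n 0 0 = box n 0 0.
  by apply/setIidr; exact: (@cube_usquare _ (Q n)).
have mg : measurable_fun (@usquare R) (EFin \o g : plane -> \bar R).
  exact: measurable_int hg.
have [|||||_ _] := @dominated_convergence _ _ _ mu _ measurable_usquare
  (fun n => (EFin \o g : plane -> \bar R) \_ (box n 0 0)) (cst 0%E) (fun x => `|g x|%:E).
- move=> n; have [H _] := @measurable_restrict _ _ _ _ _ _
    (EFin \o g : plane -> \bar R) (mb n) measurable_usquare.
  apply: H; rewrite su; apply: measurable_funS mg; first exact: measurable_usquare.
  exact: (@cube_usquare _ (Q n)).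
- exact: measurable_cst.
- exists N; split => // x /= h n _; apply: contrapT => hn; apply: h => _.
  apply: cvg_near_cst; exists n => // k /= nk.
  rewrite patchE memNset // => /(corner_sub nk); exact: hn.
- by have := integrable_abse hg.
- apply: aeW => x n _ /=; rewrite patchE; case: ifPn => // _.
  by rewrite abse0 lee_fin.
- rewrite integral0 => /fine_cvg; apply: cvg_trans; apply: near_eq_cvg.
  by apply: nearW => n /=; rewrite /Rintegral -[in LHS]integral_mkcondr su.
Qed.

(** The integrals over the corner cubes and [m] satisfy the same recurrence, so
their difference is constant; it tends to 0. *)
Lemma mass g w m : inL1 g -> cellular g w ->
  (forall k, m k - m k.+1 = sum3 (w k)) -> m @ \oo --> (0 : R) ->
  forall k, \int[mu]_(x in box k 0 0) g x = m k.
Proof.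
move=> hg cg hm m0.
pose I k := \int[mu]_(x in box k 0 0) g x.
have rec k : I k = I k.+1 + sum3 (w k).
  rewrite /I integral_box4; last first.
    apply: inL1S hg; [exact: measurable_box | exact: (@cube_usquare _ (Q k))].
  by rewrite sum4E; congr (_ + (_ + _ + _)); exact: (integral_cell _ cg).
have D0 k : I k - m k = I 0%N - m 0%N.
  by elim: k => // k <-; rewrite (rec k); have := hm k; lra.
have c1 : (fun k => I k - m k) @ \oo --> (0 : R).
  by rewrite -[X in _ --> X]subr0; apply: cvgB => //; exact: integral_corner_cvg.
have c2 : (fun k => I k - m k) @ \oo --> I 0%N - m 0%N.
  by under eq_fun do rewrite D0; exact: cvg_cst.
move=> k; apply/eqP; rewrite -subr_eq0 D0; apply/eqP.
by apply: cvg_unique c2 c1; exact: norm_hausdorff.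
Qed.

Lemma coef_corner g w m : inL1 g -> cellular g w ->
  (forall k, m k - m k.+1 = sum3 (w k)) -> m @ \oo --> (0 : R) ->
  forall k j, coef (Q k) j g = m k.+1 + sum3 (fun a b => sgn j a b * w k a b).
Proof.
move=> hg cg hm m0 k j; rewrite coef_sum4 //.
rewrite sum4E; congr (_ + (_ + _ + _)); try by congr (_ * _); exact: (integral_cell _ cg).
by rewrite /sgn !andbF !expr0 !mul1r; exact: mass hg cg hm m0 k.+1.
Qed.

Lemma sum4_sgn j : haar_index j -> sum4 (@sgn R j) = 0.
Proof.
by rewrite /sum4 /sgn; case: j => [|[|[|[|]]]] //= _;
  rewrite ?expr1 ?expr0; ring.
Qed.

(** The first ancestor that leaves the corner branch is a cell. *)
Lemma off_corner_cell n k1 k2 : (k1 < 2 ^ n)%N -> (k2 < 2 ^ n)%N ->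
  ((k1 != 0) || (k2 != 0))%N ->
  exists k (a b : bool), a || b /\ box n k1 k2 `<=` @box R k.+1 a b.
Proof.
elim: n k1 k2 => [|n IH] k1 k2; first by case: k1 => //; case: k2.
rewrite expnS => h1 h2 h.
have [e|e] := boolP ((k1./2 != 0) || (k2./2 != 0))%N.
  have [||k [a [b [ab s]]]] := IH k1./2 k2./2 _ _ e; [lia|lia|].
  exists k, a, b; split => // x hx; apply: s.
  apply: (@box_child_sub _ _ _ _ (odd k1) (odd k2)).
  by rewrite ![(_ + odd _)%N]addnC !odd_double_half.
exists n, (odd k1), (odd k2); split; first by lia.
have -> : nat_of_bool (odd k1) = k1 by lia.
by have -> : nat_of_bool (odd k2) = k2 by lia.
Qed.

(** A cube off the corner branch lies in a cell, where the function is constant. *)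
Lemma coef_off_corner g w I j : inL1 g -> cellular g w -> haar_index j ->
  ~~ corner I -> coef I j g = 0.
Proof.
move=> hg cg hj; rewrite negb_and => /(off_corner_cell (ltn_ord _) (ltn_ord _)) [k [a [b [ab s]]]].
rewrite coef_sum4 //.
transitivity (sum4 (fun a' b' => 4 ^+ k.+1 * w k a b / 4 ^+ (level I).+1 * sgn j a' b')).
  apply: eq_sum4 => a' b'; rewrite mulrC; congr (_ * _).
  by apply: integral_cst_box => x /box_child_sub /s; exact: cg.
by rewrite sum4Z sum4_sgn // mulr0.
Qed.

End Cells.

(** * Prescribing the integrals over the cells *)
Section Construction.
Context {R : realType}.
Implicit Types (n k l : nat) (a b : bool) (x : R * R) (j : nat) (f g : R * R -> R).
Implicit Types (w : nat -> bool -> bool -> R) (m : nat -> R).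
Notation mu := (leb2 R).
Notation plane := (measurableTypeR R * measurableTypeR R)%type.

(** The contribution of level [k] to the function with weights [w]. *)
Definition cell_step (w : nat -> bool -> bool -> R) k x : R :=
  4 ^+ k.+1 * sum3 (fun a b => w k a b * \1_(box k.+1 a b) x).

Lemma cell_step_in w k l a b x : a || b -> box l.+1 a b x ->
  cell_step w k x = (k == l)%:R * (4 ^+ l.+1 * w l a b).
Proof.
move=> ab h.
have E a' b' : a' || b' ->
    (\1_(box k.+1 a' b') x : R) = ((k == l) && ((a' == a) && (b' == b)))%:R.
  move=> ab'; rewrite indicE; congr (nat_of_bool _)%:R; apply/idP/idP.
    by move=> /set_mem h'; have [-> -> ->] := cell_inj ab' ab h' h; rewrite !eqxx.
  by move=> /and3P[/eqP-> /eqP-> /eqP->]; exact: mem_set.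
rewrite /cell_step /sum3 !E //; case: eqVneq => [->|_] /=; last by ring.
by move: ab; case: (a); case: (b) => //= _; ring.
Qed.

Lemma cell_step_out w k x : (forall a b, a || b -> ~ box k.+1 a b x) ->
  cell_step w k x = 0.
Proof.
by move=> h; rewrite /cell_step /sum3 !indicE !memNset ?mulr0 ?addr0 ?mulr0 //; exact: h.
Qed.

Lemma inL1_cell_step w k : inL1 (cell_step w k).
Proof.
apply: inL1Z; rewrite /sum3; repeat (apply: inL1D); apply: inL1Z;
  apply: inL1_indic; exact: measurable_box.
Qed.

Lemma integral_cell_step w k :
  \int[mu]_(x in @usquare R) cell_step w k x = sum3 (w k).
Proof.
have mb a b : measurable (box k.+1 a b : set plane) by exact: measurable_box.
have hi a b : inL1 (\1_(@box R k.+1 a b) : R * R -> R) by exact: inL1_indic.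
have I a b : \int[mu]_(x in @usquare R) (\1_(@box R k.+1 a b) x : R) = (4 ^+ k.+1)^-1.
  rewrite /Rintegral [X in fine X]integral_indic //; last exact: measurable_usquare.
  rewrite (_ : _ `&` _ = box k.+1 a b); last by apply/setIidl; exact: cell_usquare.
  by rewrite [X in fine X]leb_box.
have J a b : \int[mu]_(x in @usquare R) (w k a b * \1_(@box R k.+1 a b) x : R) =
    w k a b * (4 ^+ k.+1)^-1.
  by rewrite RintegralZl ?I //; [exact: measurable_usquare | exact: hi].
rewrite /cell_step RintegralZl; [|exact: measurable_usquare|]; last first.
  by rewrite /sum3; repeat (apply: inL1D); exact: inL1Z.
rewrite /sum3 !RintegralD; try exact: measurable_usquare; try exact: inL1Z;
  try (apply: inL1D; exact: inL1Z).
rewrite !J -!mulrDl mulrC mulrVK //.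
by rewrite unitfE expf_neq0.
Qed.

(** The sum of the contributions of all levels has at most one nonzero term at
each point, so it converges pointwise; the telescoping bound makes
the L1 norm at most [phi 0]. *)
Lemma exists_cellular w (phi : nat -> R) :
  (forall k, sum3 (fun a b => `|w k a b|) <= phi k - phi k.+1) ->
  (forall k, 0 <= phi k) -> exists f, inL1 f /\ cellular f w.
Proof.
move=> hw phi0.
pose F n x := \sum_(0 <= k < n) cell_step w k x.
pose v n x := \sum_(0 <= k < n) cell_step (fun k a b => `|w k a b|) k x.
have Fin l a b x n : a || b -> box l.+1 a b x -> (l < n)%N ->
    F n x = 4 ^+ l.+1 * w l a b.
  move=> ab h ln; rewrite /F big_mkord (bigD1 (Ordinal ln)) //= big1 => [|i il].
    by rewrite (cell_step_in _ _ ab h) eqxx mul1r addr0.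
  by rewrite (cell_step_in _ _ ab h) -val_eqE /= in il *; rewrite (negbTE il) mul0r.
have Fout x n : (forall l a b, a || b -> ~ box l.+1 a b x) -> F n x = 0.
  by move=> h; rewrite /F big1 // => i _; apply: cell_step_out => a b; exact: h.
pose f x := limn (fun n => F n x).
have fin l a b x : a || b -> box l.+1 a b x -> f x = 4 ^+ l.+1 * w l a b.
  move=> ab h; apply: lim_near_cst; first exact: norm_hausdorff.
  by exists l.+1 => // n /= ln; exact: Fin h ln.
have fout x : (forall l a b, a || b -> ~ box l.+1 a b x) -> f x = 0.
  move=> h; apply: lim_near_cst; first exact: norm_hausdorff.
  by exists 0%N => // n _; exact: Fout.
have dec x : (exists l a b, a || b /\ box l.+1 a b x) \/
    (forall l a b, a || b -> ~ box l.+1 a b x).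
  have [h|h] := pselect (exists l a b, a || b /\ box l.+1 a b x); first by left.
  by right=> l a b ab hx; apply: h; exists l, a, b.
have Fcvg x : F n x @[n --> \oo] --> f x.
  case: (dec x) => [[l [a [b [ab h]]]]|h].
    rewrite (fin _ _ _ _ ab h); apply: cvg_near_cst.
    by exists l.+1 => // n /= ln; exact: Fin h ln.
  by rewrite fout //; apply: cvg_near_cst; exists 0%N => // n _; exact: Fout.
have mF n : measurable_fun (@usquare R) (F n : plane -> R).
  apply/measurable_EFinP; apply: measurable_int (_ : mu.-integrable _ _).
  by apply: inL1_sum => i; exact: inL1_cell_step.
have mf : measurable_fun (@usquare R) (f : plane -> R).
  exact: measurable_fun_cvg mF (fun x _ => Fcvg x).
exists f; split; last by move=> k a b ab x h; exact: fin.
pose w' k a b := `|w k a b|.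
have st0 k x : 0 <= cell_step w' k x.
  apply: mulr_ge0; first exact: exprn_ge0.
  by rewrite /sum3; repeat (apply: addr_ge0); apply: mulr_ge0;
    rewrite ?indicE ?ler0n ?normr_ge0.
have mst k : measurable_fun (@usquare R) (fun x : plane => (cell_step w' k x)%:E).
  by apply: measurable_int (_ : mu.-integrable _ _); exact: inL1_cell_step.
apply/integrableP; split; first exact/measurable_EFinP.
have dom x : (`|(f x)%:E| <= \sum_(0 <= k <oo) (cell_step w' k x)%:E)%E.
  case: (dec x) => [[l [a [b [ab h]]]]|h]; last first.
    by rewrite fout // abse0; apply: nneseries_ge0 => k _ _; rewrite lee_fin.
  apply: (@le_trans _ _ (\sum_(0 <= k < l.+1) (cell_step w' k x)%:E)%E); last first.
    by apply: nneseries_lim_ge => k _ _; rewrite lee_fin.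
  rewrite big_nat_recr //= (cell_step_in w' _ ab h) eqxx mul1r (fin _ _ _ _ ab h).
  rewrite normrM ger0_norm ?exprn_ge0 //.
  by rewrite leeDr // sume_ge0 // => k _; rewrite lee_fin.
apply: (@le_lt_trans _ _ (\int[mu]_(x in @usquare R)
    \sum_(0 <= k <oo) (cell_step w' k x)%:E)%E).
  apply: ge0_le_integral => //.
  - exact: measurable_usquare.
  - by apply: measurableT_comp => //; exact/measurable_EFinP.
  - apply: (ge0_emeasurable_sum (P := xpredT)); last by move=> k _; exact: mst.
    by move=> k x _ _; rewrite lee_fin.
  - by move=> x _; exact: dom.
rewrite integral_nneseries //; [|exact: measurable_usquare|]; last first.
  by move=> k x _; rewrite lee_fin.
apply: (@le_lt_trans _ _ (phi 0%N)%:E); last exact: ltry.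
apply: lime_le.
  by apply: is_cvg_nneseries => k _ _; apply: integral_ge0 => x _; rewrite lee_fin.
apply: nearW => n.
apply: (@le_trans _ _ (phi 0%N - phi n)%:E); last by rewrite lee_fin gerBl.
elim: n => [|n IH]; first by rewrite big_nil subrr.
rewrite big_nat_recr //=.
have -> : (\int[mu]_(x in @usquare R) (cell_step w' n x)%:E)%E = (sum3 (w' n))%:E.
  rewrite -integral_cell_step /Rintegral fineK //.
  by apply: integrable_fin_num (inL1_cell_step w' n); exact: measurable_usquare.
apply: (le_trans (leeD IH (_ : _ <= (phi n - phi n.+1)%:E)%E)); first by rewrite lee_fin hw.
by rewrite -EFinD lee_fin; lra.
Qed.

End Construction.

(** * Orthogonality and order along the corner branch *)
Section CornerHaar.
Context {R : realType}.
Implicit Types (n k l : nat) (a b : bool) (x : R * R) (i j : nat).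

(** The value of the Haar function of [Q l] on the cell [(a, b)] of level [k]. *)
Definition corner_haar_value l j k a b : R :=
  if (k < l)%N then 0 else if k == l then 4 ^+ l * sgn j a b else 4 ^+ l.

Lemma haar_cell l j k a b x : a || b -> box k.+1 a b x ->
  haar (Q l) j x = corner_haar_value l j k a b.
Proof.
move=> ab h; rewrite /corner_haar_value; case: ltngtP => kl.
- apply: haar_out => h'.
  have h2 := corner_sub kl (h' : box l 0 0 x).
  by have [] := box_inj h h2; case: a ab {h} => //; case: b.
- have h2 := corner_sub kl (cell_sub h).
  by rewrite (@haar_child _ (Q l) j false false) // /sgn !andbF !mulr1.
- by subst k; rewrite (@haar_child _ (Q l) j a b).
Qed.

Lemma cellular_haar l j :
  cellular (haar (Q l) j) (fun k a b => corner_haar_value l j k a b / 4 ^+ k.+1).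
Proof.
by move=> k a b ab x h; rewrite (haar_cell _ _ ab h) mulrC divfK.
Qed.

Lemma cvg_pow4 (c : R) : (fun k => c / 4 ^+ k) @ \oo --> (0 : R).
Proof.
have : geometric c (4^-1) @ \oo --> (0 : R).
  by apply: cvg_geometric; rewrite ger0_norm ?invr_ge0 // invf_lt1 // ltr1n.
by under [X in _ -> X @ _ --> _]eq_fun do rewrite -exprVn.
Qed.

(** A corner Haar function is itself constant on cells, with mass 0 down to its
own level; the formula for the coefficients of such functions then yields
orthogonality. *)
Lemma coef_haar I i l j : haar_index i -> haar_index j ->
  coef I i (haar (Q l) j) = (corner I && ((level I == l) && (i == j)))%:R :> R.
Proof.
move=> hi hj; case: (boolP (corner I)) => [/cornerE->|hI]; last first.
  by rewrite (coef_off_corner (inL1_haar _ _) (cellular_haar l j)).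
rewrite /=; move: (level I) => k {I}.
have sgn00 j' : sgn j' false false = 1 :> R by rewrite /sgn !andbF !mulr1.
have s3 j' : haar_index j' -> sum3 (@sgn R j') = -1.
  by move=> /(@sum4_sgn R); rewrite sum4E sgn00; lra.
pose m n : R := if (n <= l)%N then 0 else 4 ^+ l / 4 ^+ n.
have p n : (4 : R) ^+ n != 0 by rewrite expf_neq0.
rewrite (coef_corner (m := m) (inL1_haar _ _) (cellular_haar l j)).
- rewrite /m /corner_haar_value; case: ltngtP => kl /=.
  + by rewrite /sum3 !mul0r !mulr0 !addr0.
  + have -> : sum3 (fun a b => sgn i a b * (4 ^+ l / 4 ^+ k.+1)) =
        sum3 (sgn i) * (4 ^+ l / 4 ^+ k.+1) :> R by rewrite /sum3; ring.
    by rewrite s3 //; ring.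
  + subst k; rewrite exprS; move: (p l); set z := 4 ^+ l => z0.
    rewrite /sum3 /sgn; move: i j hi hj {s3 m sgn00} => [|[|[|[|i]]]] [|[|[|[|j]]]] // _ _;
      rewrite /= ?expr1 ?expr0; field; exact: z0.
- move=> n; rewrite /m /corner_haar_value; case: (ltngtP n l) => nl /=.
  + by rewrite /sum3 !mul0r !addr0 subr0.
  + rewrite exprS /sum3; field; exact: p.
  + subst n; rewrite exprS; have := s3 j hj; rewrite /sum3.
    move: (p l); set z := 4 ^+ l => z0 h.
    transitivity (4^-1 * (sgn j false true + sgn j true false + sgn j true true) : R).
      by rewrite h; field.
    by field.
- apply: cvg_trans (cvg_pow4 (4 ^+ l)); apply: near_eq_cvg.
  by exists l.+1 => // n /= ln; rewrite /m leqNgt ln.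
Qed.

Lemma coef_unit I i : haar_index i ->
  coef I i (\1_(ico (0, 1) `*` ico (0, 1)) : R * R -> R) = 0.
Proof.
move=> hi.
have E : ico (0, 1) `*` ico (0, 1) = @box R 0 0 0.
  by rewrite /box /dyad expr0 !divr1.
rewrite E.
have L : inL1 (\1_(@box R 0 0 0) : R * R -> R) by apply: inL1_indic; exact: measurable_box.
have p n : (4 : R) ^+ n != 0 by rewrite expf_neq0.
have C : cellular (\1_(@box R 0 0 0) : R * R -> R) (fun k _ _ => (4 ^+ k.+1)^-1).
  move=> k a b ab x h; rewrite indicE mem_set ?divff //.
  exact: corner_sub (leq0n k) _ (cell_sub h).
case: (boolP (corner I)) => [/cornerE->|hI]; last by rewrite (coef_off_corner L C).
rewrite (coef_corner (m := fun k => 1 / 4 ^+ k) L C).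
- have := sum4_sgn (R := R) hi; rewrite sum4E {1}/sgn !andbF !mulr1 => h.
  transitivity ((1 + sum3 (@sgn R i)) / 4 ^+ (level I).+1); first by rewrite /sum3; ring.
  by rewrite h mul0r.
- by move=> k; rewrite /sum3 exprS; field.
- exact: cvg_pow4.
Qed.

(** The chains of cubes above a corner cube stay on the corner branch, where
inclusion is the comparison of levels. *)
Lemma corner_subE k T :
  cube_set (Q k) `<=` @cube_set R T <-> corner T /\ (level T <= k)%N.
Proof.
have p n : (0 : R) < 2 ^+ n by rewrite exprn_gt0.
have in00 n (y : R) : 0 <= y -> y * 2 ^+ n < 1 -> ico (dyad n 0) y.
  by move=> y0 y1; apply/in_dyadE; rewrite add0r y1 mulr_ge0 // ltW.
split=> [s|[/cornerE -> h]]; last exact: (corner_sub h).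
have h0 : @cube_set R T (0, 0).
  by apply: s; split; apply: in00 => //=; rewrite mul0r.
have cT : corner T.
  case: h0 => [/in_dyadE h1 /in_dyadE h2]; move: h1 h2; rewrite /= mul0r.
  move=> /andP[h1 _] /andP[h2 _]; move: h1 h2; rewrite !lern0 /corner => -> ->//.
split=> //; rewrite leqNgt; apply/negP => kT.
have : @cube_set R T ((2 ^+ level T)^-1, 0).
  apply: s; split; apply: in00 => //=; rewrite ?invr_ge0 ?mul0r // ?ltW //.
  by rewrite mulrC ltr_pdivrMr // mul1r ltr_eXn2l // ltr1n.
case/andP: cT => /eqP e _ [/in_dyadE /andP[_ +] _].
by rewrite e mulVf ?gt_eqF // add0r ltxx.
Qed.

Lemma prec_corner k l : (k < l)%N -> @prec R (Q k) (Q l).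
Proof.
move=> kl; left; rewrite /side1 /dyad /=; left.
by rewrite !mul0r !subr0 !mul1r ltf_pV2 ?posrE ?exprn_gt0 // ltr_eXn2l // ltr1n.
Qed.

End CornerHaar.

(** * One selection of the algorithm, read off the coefficients *)
Section Selection.
Context {R : realType}.
Implicit Types (n k l : nat) (i j : nat) (rho : nat -> nat -> R).

(** The chain condition for the corner cubes from level [l] down to the level [k]
of the maximal coefficient. *)
Definition levels_above (s : R) rho k j l : Prop :=
  (l <= k)%N /\ forall n, (l <= n <= k)%N ->
    exists2 i, haar_index i & s * `|rho k j| <= `|rho n i|.

(** The consequences of one selection of the algorithm, at level [l] and index
[i], for a residual with corner coefficients [rho] and no other ones. *)
Definition picks (s t : R) rho l i : Prop := exists k j,
  [/\ haar_index j /\ (forall k' j', haar_index j' -> `|rho k' j'| <= `|rho k j|),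
      levels_above s rho k j l,
      forall l', levels_above s rho k j l' -> (l <= l')%N
    & haar_index i /\ forall j', haar_index j' -> t / s * `|rho l j'| <= `|rho l i|].

Lemma haar_indexP j : haar_index j -> [\/ j = 1%N, j = 2%N | j = 3%N].
Proof.
by case: j => [|[|[|[|]]]] // _; [constructor 1|constructor 2|constructor 3].
Qed.

Lemma max3_le (F : nat -> R) (y : R) : (0 <= y) ->
  (\big[Order.max/0]_(1 <= j < 4) F j <= y) <->
  (forall j, haar_index j -> F j <= y).
Proof.
move=> y0; rewrite unlock /= !ge_max y0 andbT; split.
  by move=> /and3P[h1 h2 h3] j /haar_indexP[]->.
by move=> h; rewrite !h.
Qed.

Lemma le_max3 (F : nat -> R) j : haar_index j ->
  F j <= \big[Order.max/0]_(1 <= j < 4) F j.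
Proof.
by move: j; apply/max3_le => //; rewrite unlock /= !le_max lexx !orbT.
Qed.

Lemma seq_argmin (T : eqType) (F : T -> R) (u : seq T) x0 : x0 \in u ->
  exists2 x, x \in u & forall y, y \in u -> F x <= F y.
Proof.
elim: u x0 => // z u IH x0 _; case: u IH => [|z' u] IH.
  by exists z; rewrite ?inE // => y; rewrite inE => /eqP->.
have [x xu h] := IH z' (mem_head _ _).
have [zx|zx] := leP (F z) (F x).
  exists z; first exact: mem_head.
  by move=> y; rewrite inE => /predU1P[->//|/h]; exact: le_trans.
exists x; first by rewrite inE xu orbT.
by move=> y; rewrite inE => /predU1P[->|/h//]; exact: ltW.
Qed.

Lemma min_nat (P : nat -> Prop) : (exists n, P n) ->
  exists2 n, P n & forall k, P k -> (n <= k)%N.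
Proof.
move=> [n0 p0]; have ex : exists n, `[< P n >] by exists n0; exact/asboolP.
case: (ex_minnP ex) => n /asboolP Pn h; exists n => // k Pk.
by apply: h; exact/asboolP.
Qed.

Variables (r : R * R -> R) (rho : nat -> nat -> R) (s t : R).
Hypothesis r_corner : forall k j, haar_index j -> coef (Q k) j r = rho k j.
Hypothesis r_off : forall I j, haar_index j -> ~~ corner I -> coef I j r = 0.
Hypothesis rho_neq0 : exists k j, haar_index j /\ rho k j != 0.
Hypothesis t_gt0 : 0 < t.
Hypothesis t_le_s : t <= s.
Hypothesis s_le1 : s <= 1.

Lemma coef_cornerE I j : corner I -> haar_index j ->
  coef I j r = rho (level I) j.
Proof. by move=> cI hj; rewrite {1}(cornerE cI) r_corner. Qed.

(** A nonzero coefficient sits on the corner branch. *)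
Lemma max_coef_corner I j : max_coef r I j ->
  corner I /\ forall k i, haar_index i -> `|rho k i| <= `|rho (level I) j|.
Proof.
move=> [hj hm]; case: (boolP (corner I)) => cI; last first.
  have [k [i [hi]]] := rho_neq0; rewrite -(r_corner k hi) -normr_gt0 => h.
  by have := lt_le_trans h (hm (Q k) i hi); rewrite r_off // normr0 ltxx.
split=> // k i hi; have := hm (Q k) i hi.
by rewrite r_corner // coef_cornerE.
Qed.

Lemma max_corner_coef k j : haar_index j ->
  (forall k' i, haar_index i -> `|rho k' i| <= `|rho k j|) ->
  max_coef r (Q k) j.
Proof.
move=> hj hm; split => // J i hi; rewrite r_corner //.
case: (boolP (corner J)) => [/cornerE->|cJ]; first by rewrite r_corner // hm.
by rewrite r_off // normr0.
Qed.

Lemma chain_cornerE k j T : haar_index j ->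
  chain_cond s r (Q k) j T <-> corner T /\ levels_above s rho k j (level T).
Proof.
move=> hj; rewrite /chain_cond r_corner //; split.
  move=> [/corner_subE[cT lT] h]; do 2!split => //.
  move=> n /andP[n1 n2]; have [||i hi] := h (Q n).
  - by apply/corner_subE; split.
  - by rewrite (cornerE cT); apply/corner_subE; split.
  - by rewrite r_corner // => ?; exists i.
move=> [cT [lT h]]; split; first exact/corner_subE.
move=> I /corner_subE[cI lI]; rewrite (cornerE cI) (cornerE cT).
move=> /corner_subE[_ lTI]; rewrite -(cornerE cI).
have [|i hi] := h (level I); first by rewrite lTI.
by exists i => //; rewrite coef_cornerE.
Qed.

Lemma selection_corner D j T i :
  first_max_coef r D j -> largest_chain s r D j T ->
  smallest_admissible s t r T i -> corner T /\ picks s t rho (level T) i.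
Proof.
move=> [mD _ _] [hT lT] [[hi adm] _].
have hj : haar_index j by case: mD.
have [cD maxD] := max_coef_corner mD; have eD := cornerE cD.
rewrite eD in hT lT; have [cT aT] := (chain_cornerE _ _ hj).1 hT.
split => //; exists (level D), j; split => //.
  move=> l' al'; have := lT (Q l') ((chain_cornerE _ (Q l') hj).2 (conj isT al')).
  by rewrite (cornerE cT) => /corner_subE[].
split => // j' hj'; rewrite -!coef_cornerE //.
apply: le_trans adm; rewrite ler_wpM2l //.
  by rewrite divr_ge0 ?ltW // (lt_le_trans t_gt0).
exact: (le_max3 (fun j => `|coef T j r|)).
Qed.

Hypothesis rho_cvg : forall e, 0 < e -> exists N, forall k j, (N <= k)%N ->
  haar_index j -> `|rho k j| < e.

Lemma exists_max : exists k j, haar_index j /\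
  forall k' i, haar_index i -> `|rho k' i| <= `|rho k j|.
Proof.
have [k0 [j0 [hj0 /[dup] n0]]] := rho_neq0; rewrite -normr_gt0 => /rho_cvg[N hN].
pose u := [seq (k, j) | k <- iota 0 N, j <- [:: 1; 2; 3]%N].
have inu k j : haar_index j -> (k < N)%N -> (k, j) \in u.
  by move=> hj kN; apply: allpairs_f; [rewrite mem_iota | case/haar_indexP: hj => ->].
have k0N : (k0 < N)%N by rewrite ltnNge; apply/negP => h; have := hN _ _ h hj0; rewrite ltxx.
have [[k j] kj h] := @seq_argmin _ (fun q => - `|rho q.1 q.2|) u _ (inu _ _ hj0 k0N).
have hj : haar_index j.
  by move: kj => /allpairsP[[k1 j1] /= [_ + [_ ->]]]; rewrite !inE => /or3P[]/eqP->.
exists k, j; split => // k' i hi.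
have h0 := h _ (inu _ _ hj0 k0N); rewrite /= lerN2 in h0.
have [k'N|k'N] := ltnP k' N.
  by have := h _ (inu _ _ hi k'N); rewrite /= lerN2.
exact: le_trans (ltW (hN _ _ k'N hi)) h0.
Qed.

(** Coefficients tend to 0, so a maximal one exists among finitely many levels;
the first such level, the least index, the top of the chain and the smallest
admissible coefficient are then minima over sets of integers or over three
indices. *)
Lemma selection_exists : exists D j T i,
  [/\ first_max_coef r D j, largest_chain s r D j T & smallest_admissible s t r T i].
Proof.
have s0 : 0 < s := lt_le_trans t_gt0 t_le_s.
have [k [j0 [hj0 m0]] kmin] := min_nat exists_max.
pose M j := haar_index j /\ forall k' i, haar_index i -> `|rho k' i| <= `|rho k j|.
have [j [hj mj] jmin] := @min_nat M (ex_intro _ j0 (conj hj0 m0)).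
have lk : levels_above s rho k j k.
  split=> // n; rewrite -eqn_leq => /eqP<-; exists j => //.
  by rewrite ler_piMl.
have [l al lmin] := min_nat (ex_intro _ k lk).
have mem3 j' : haar_index j' -> j' \in [:: 1; 2; 3]%N by move=> /haar_indexP[]->.
have [i1 i1u i1max] := @seq_argmin _ (fun j => - `|rho l j|) _ _ (mem3 j hj).
have h3 i : i \in [:: 1; 2; 3]%N -> haar_index i by rewrite !inE => /or3P[]/eqP->.
pose adm i := t / s * `|rho l i1| <= `|rho l i|.
have admE i : haar_index i -> admissible_index s t r (Q l) i <-> adm i.
  move=> hi; rewrite /admissible_index r_corner // /adm.
  have -> : \big[Order.max/0]_(1 <= j < 4) `|coef (Q l) j r| = `|rho l i1|.
    apply/eqP; rewrite eq_le; apply/andP; split.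
      by apply/max3_le => // j' hj'; rewrite r_corner // -lerN2; apply/i1max/mem3.
    by rewrite -r_corner ?h3 //; apply: (le_max3 (fun j => `|coef (Q l) j r|)); exact: h3.
  by split=> [[]|].
have adm1 : adm i1.
  by rewrite /adm ler_piMl // ler_pdivrMr // mul1r.
have [i iu imin] := @seq_argmin _ (fun j => `|rho l j|) [seq i <- [:: 1; 2; 3]%N | adm i] i1
  (etrans (mem_filter _ _ _) (introT andP (conj adm1 i1u))).
move: iu; rewrite mem_filter => /andP[admi /h3 hi].
exists (Q k), j, (Q l), i; split.
- split; first exact: max_corner_coef.
    move=> I i' mI; have [cI hI] := max_coef_corner mI.
    have : (k <= level I)%N by apply: kmin; exists i'; split => //; case: mI.
    rewrite leq_eqVlt (cornerE cI) => /predU1P[->|kI]; first by left.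
    by right; exact: prec_corner.
  move=> i' mi'; apply: jmin; have [_ h] := max_coef_corner mi'.
  by split => //; case: mi'.
- split; first by apply/chain_cornerE.
  move=> J /(chain_cornerE _ _ hj)[cJ aJ]; rewrite (cornerE cJ).
  by apply: corner_sub; exact: lmin.
- split; first exact/admE.
  move=> j' /[dup] -[hj' _] /(admE _ hj') aj'; rewrite !r_corner //.
  by apply: imin; rewrite mem_filter aj' mem3.
Qed.

End Selection.

(** * Runs of the algorithm *)
Section Run.
Context {R : realType}.
Implicit Types (n k l : nat) (i j : nat) (S X Y : seq (nat * nat)).
Notation mu := (leb2 R).

Variables (f : R * R -> R) (c : nat -> nat -> R) (s t : R).
Hypothesis f_L1 : inL1 f.
Hypothesis f_corner : forall k j, haar_index j -> coef (Q k) j f = c k j.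
Hypothesis f_off : forall I j, haar_index j -> ~~ corner I -> coef I j f = 0.
Hypothesis c_cvg : forall e, 0 < e -> exists N, forall k j, (N <= k)%N ->
  haar_index j -> `|c k j| < e.
Hypothesis c_neq0 : forall k j, haar_index j -> c k j != 0.
Hypothesis t_gt0 : 0 < t.
Hypothesis t_le_s : t <= s.
Hypothesis s_le1 : s <= 1.

Definition haar_sum S (x : R * R) : R :=
  \sum_(q <- S) c q.1 q.2 * haar (Q q.1) q.2 x.

Definition approx S (x : R * R) : R :=
  (\int[mu]_(y in @usquare R) f y) * \1_(ico (0, 1) `*` ico (0, 1)) x + haar_sum S x.

Definition valid S := uniq S && all (fun q => haar_index q.2) S.

(** The corner coefficients that remain after the pairs (level, index) of [S] have
been selected. *)
Definition residual S k j : R := if (k, j) \in S then 0 else c k j.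

Lemma inL1_haar_sum S : inL1 (haar_sum S).
Proof. by apply: inL1_sum => q; apply: inL1Z; exact: inL1_haar. Qed.

Lemma inL1_unit : inL1 (\1_(ico (0, 1) `*` ico (0, 1)) : R * R -> R).
Proof. by apply: inL1_indic; apply: measurableX; exact: measurable_ico. Qed.

Lemma inL1_approx S : inL1 (approx S).
Proof. by apply: inL1D; [apply: inL1Z; exact: inL1_unit | exact: inL1_haar_sum]. Qed.

Lemma coef_haar_sum S I j : valid S -> haar_index j ->
  coef I j (haar_sum S) = if corner I && ((level I, j) \in S) then c (level I) j else 0.
Proof.
move=> + hj; elim: S => [_|[l i] S IH].
  have -> : haar_sum [::] = (fun x => 0 * haar_sum [::] x).
    by apply/funext => x; rewrite /haar_sum big_nil mul0r.
  by rewrite haar_coefZ ?mul0r ?andbF //; exact: inL1_haar_sum.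
rewrite /valid /= => /andP[/andP[nS uS] /andP[hi vS]].
rewrite /haar_sum; under eq_fun do rewrite big_cons.
rewrite haar_coefD ?haar_coefZ ?IH ?/valid ?uS //; [|exact: inL1_haar|
  by apply: inL1Z; exact: inL1_haar|exact: inL1_haar_sum].
rewrite coef_haar // inE xpair_eqE; case: (corner I) => /=; last by rewrite mulr0 addr0.
case: eqVneq => [e1|_] /=; last by rewrite mulr0 add0r.
case: eqVneq => [e2|_] /=; last by rewrite mulr0 add0r.
by rewrite e1 e2 (negbTE nS) mulr1 addr0.
Qed.

Lemma coef_residual S I j : valid S -> haar_index j ->
  coef I j (f \- approx S) = if corner I then residual S (level I) j else 0.
Proof.
move=> vS hj; rewrite (haar_coefB _ _ f_L1 (inL1_approx S)).
rewrite haar_coefD ?haar_coefZ; [|exact: inL1_unit|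
  by apply: inL1Z; exact: inL1_unit|exact: inL1_haar_sum].
rewrite coef_unit // mulr0 add0r coef_haar_sum // /residual.
case: (boolP (corner I)) => cI /=; last by rewrite f_off // subr0.
rewrite {1}(cornerE cI) f_corner //.
by case: ifP => _; rewrite ?subrr ?subr0.
Qed.

Lemma residual_corner S k j : valid S -> haar_index j ->
  coef (Q k) j (f \- approx S) = residual S k j.
Proof. by move=> vS hj; rewrite coef_residual. Qed.

Lemma residual_off S I j : valid S -> haar_index j -> ~~ corner I ->
  coef I j (f \- approx S) = 0.
Proof. by move=> vS hj /negbTE cI; rewrite coef_residual // cI. Qed.

Lemma residual_neq0 S : exists k j, haar_index j /\ residual S k j != 0.
Proof.
(* This level exceeds all those that occur in S. *)
pose N := \sum_(q <- S) q.1.+1; exists N, 1%N; split => //.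
rewrite /residual; case: ifPn => [inS|_]; last exact: c_neq0.
have : (N.+1 <= N)%N by rewrite [leqRHS](big_rem _ inS) /= leq_addr.
by rewrite ltnn.
Qed.

Lemma residual_cvg S e : 0 < e -> exists N, forall k j, (N <= k)%N ->
  haar_index j -> `|residual S k j| < e.
Proof.
move=> e0; have [N hN] := c_cvg e0; exists N => k j kN hj.
by rewrite /residual; case: ifP => _; rewrite ?normr0 // hN.
Qed.

Lemma not_null S : valid S ->
  ~ {ae mu, forall x, usquare x -> (f \- approx S) x = 0}.
Proof.
move=> vS h; have [k [j [hj]]] := residual_neq0 S.
rewrite -(residual_corner _ vS hj) coef_null ?eqxx //.
by apply: inL1B => //; exact: inL1_approx.
Qed.

Lemma approx_cons l i S x :
  approx ((l, i) :: S) x = approx S x + c l i * haar (Q l) i x.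
Proof. by rewrite /approx /haar_sum big_cons -addrA; congr (_ + _); rewrite addrC. Qed.

Lemma approx_perm S S' : perm_eq S S' -> approx S = approx S'.
Proof. by move=> p; apply/funext => x; rewrite /approx /haar_sum (perm_big _ p). Qed.

(** The first factor [s] is lost along the chain, the second one, [t / s], in the
choice of the index. *)
Lemma picks_bound rho l i : picks s t rho l i ->
  haar_index i /\ forall k j, haar_index j -> t * `|rho k j| <= `|rho l i|.
Proof.
have s0 : 0 < s := lt_le_trans t_gt0 t_le_s.
move=> [k [j [[hj m] [lk ch] _ [hi adm]]]]; split => // k' j' hj'.
apply: (@le_trans _ _ (t * `|rho k j|)); first by rewrite ler_pM2l // m.
have [|i' hi' h] := ch l; first by rewrite leqnn.
apply: le_trans (adm i' hi').
by rewrite -mulrA ler_pM2l // mulrC ler_pdivlMr // mulrC.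
Qed.

Lemma picks_notin S l i : picks s t (residual S) l i -> (l, i) \notin S.
Proof.
move=> /picks_bound[hi h]; apply/negP => inS.
have [k [j [hj]]] := residual_neq0 S; rewrite -normr_gt0 => h0.
have := h k j hj; rewrite {2}/residual inS normr0 leNgt => /negP; apply.
exact: mulr_gt0.
Qed.

Lemma step_picks S G' : valid S -> wga_step s t f (approx S) G' ->
  exists l i, [/\ picks s t (residual S) l i, valid ((l, i) :: S)
    & G' = approx ((l, i) :: S)].
Proof.
move=> vS [_ /(_ (not_null vS)) [D [j [T [i [h1 h2 h3 h4]]]]]].
have [cT pT] := selection_corner (fun k j => residual_corner k vS)
  (fun I j => residual_off vS) (residual_neq0 S) t_gt0 t_le_s h1 h2 h3.
have [hi _] := picks_bound pT.
exists (level T), i; split => //.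
  by move: vS; rewrite /valid /= picks_notin // hi.
apply/funext => x; rewrite h4 approx_cons; congr (_ + _ * _).
  by rewrite (cornerE cT) f_corner.
by rewrite {1}(cornerE cT).
Qed.

Lemma step_exists S : valid S -> exists q, valid (q :: S) /\
  wga_step s t f (approx S) (approx (q :: S)).
Proof.
move=> vS.
have [D [j [T [i [h1 h2 h3]]]]] := selection_exists (fun k j => residual_corner k vS)
  (fun I j => residual_off vS) (residual_neq0 S) t_gt0 t_le_s s_le1 (residual_cvg S).
pose G' x := approx S x + coef T i f * haar T i x.
have st : wga_step s t f (approx S) G'.
  by split=> [/(not_null vS)//|_]; exists D, j, T, i.
have [l [i' [_ v e]]] := step_picks vS st.
by exists (l, i'); split => //; rewrite -e.
Qed.

Lemma approx0 x : approx [::] x =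
  (\int[mu]_(y in @usquare R) f y) * \1_(ico (0, 1) `*` ico (0, 1)) x.
Proof. by rewrite /approx /haar_sum big_nil addr0. Qed.

Lemma run_exists : exists G, wga_run s t f G.
Proof.
have ex S : exists q, valid S -> valid (q :: S) /\
    wga_step s t f (approx S) (approx (q :: S)).
  have [vS|vS] := boolP (valid S); last by exists (0%N, 0%N).
  by have [q hq] := step_exists vS; exists q.
have [nx hnx] := boolp.choice ex.
pose st n := iter n (fun S => nx S :: S) [::].
have vst n : valid (st n) by elim: n => // n IH; have [] := hnx _ IH.
exists (fun n => approx (st n)); split; first exact: approx0.
by move=> n; have [] := hnx _ (vst n).
Qed.

(** Starting from [X], every selection is made in [Y] until [Y] is exhausted. *)
Definition forces X Y := forall S l i,
  {subset X <= S} -> {subset S <= X ++ Y} -> ~ {subset Y <= S} ->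
  picks s t (residual S) l i -> (l, i) \in Y.

(** [Y] is a concatenation of parts, each of which is exhausted before the next one
is touched; the order inside a part is free. *)
Inductive forced X : seq (nat * nat) -> Prop :=
| forced_nil : forced X [::]
| forced_cat Y Z : forced X Y -> valid (X ++ (Y ++ Z)) -> forces (X ++ Y) Z ->
    forced X (Y ++ Z).

Section Stages.
Variable G : nat -> R * R -> R.
Hypothesis G_run : wga_run s t f G.

(** Selected pairs are never selected again, so after [size Y] steps exactly [Y]
has been added. *)
Lemma stage m X Y : valid (X ++ Y) -> G m = approx X -> forces X Y ->
  G (m + size Y)%N = approx (X ++ Y).
Proof.
move eY : (size Y) => n; elim: n m X Y eY => [|n IH] m X Y eY vXY em h.
  by rewrite addn0 em; move: eY {vXY h} => /size0nil ->; rewrite cats0.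
have vX : valid X.
  by move: vXY; rewrite /valid cat_uniq all_cat => /andP[/andP[-> _] /andP[-> _]].
have [l [i [pk v e]]] : exists l i, [/\ picks s t (residual X) l i,
    valid ((l, i) :: X) & G m.+1 = approx ((l, i) :: X)].
  by apply: step_picks => //; rewrite -em; apply: G_run.2.
have uXY : uniq (X ++ Y) by case/andP: vXY.
have disj q : q \in X -> q \in Y -> False.
  move=> qX qY; move: uXY; rewrite cat_uniq => /and3P[_ /hasPn/(_ q qY) + _].
  by rewrite /= qX.
have nsub : ~ {subset Y <= X}.
  case: Y {IH vXY h uXY} eY disj => // q Y _ disj /(_ q (mem_head _ _)) /disj.
  by apply; exact: mem_head.
have inY : (l, i) \in Y.
  by apply: h pk => // q qX; rewrite mem_cat qX.
have pe : perm_eq (((l, i) :: X) ++ rem (l, i) Y) (X ++ Y).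
  by rewrite -cat1s -catA perm_catCA perm_cat2l perm_sym; exact: perm_to_rem.
rewrite addnS -addSn -(approx_perm pe); apply: IH => //.
- by rewrite size_rem // eY.
- by rewrite /valid (perm_uniq pe) (perm_all _ pe).
move=> S l' i' sX sS nS pk'; have nin := picks_notin pk'.
have uY : uniq Y by move: uXY; rewrite cat_uniq => /and3P[].
rewrite mem_rem_uniq // inE; apply/andP; split.
  by apply: contraNneq nin => ->; apply: sX; exact: mem_head.
apply: (h S) => //.
- by move=> q qX; apply: sX; rewrite inE qX orbT.
- by move=> q /sS; rewrite (perm_mem pe).
- move=> sub; apply: nS => q qY; apply: sub; exact: mem_rem qY.
Qed.

Lemma stage_forced m X Y : forced X Y -> G m = approx X ->
  G (m + size Y)%N = approx (X ++ Y).
Proof.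
move=> h e; elim: h => [|{}Y Z _ IH vXYZ hZ]; first by rewrite addn0 cats0.
by rewrite size_cat addnA catA; apply: stage => //; rewrite -catA.
Qed.

Definition full_levels n : seq (nat * nat) :=
  [seq (k, j) | k <- iota 0 n, j <- [:: 1; 2; 3]%N].

Lemma mem_full_levels n k j :
  ((k, j) \in full_levels n) = (k < n)%N && haar_index j.
Proof.
apply/allpairsP/idP => [[[k' j'] /= [+ + [-> ->]]]|/andP[kn /haar_indexP hj]].
  by rewrite mem_iota add0n /= => ->; rewrite !inE => /or3P[]/eqP->.
by exists (k, j); split => //=; [rewrite mem_iota|case: hj => ->].
Qed.

Lemma valid_full_levels n : valid (full_levels n).
Proof.
apply/andP; split; first by apply: allpairs_uniq => //; [exact: iota_uniq|case=> ? ? [? ?]].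
by apply/allP => -[k j]; rewrite mem_full_levels => /andP[].
Qed.

Lemma size_full_levels n : size (full_levels n) = (n * 3)%N.
Proof. by rewrite size_allpairs size_iota. Qed.

Definition gap n := forall k k' j j', (k < n <= k')%N -> haar_index j ->
  haar_index j' -> `|c k' j'| < t * `|c k j|.

(** A selected coefficient is at least [t] times the maximum, which the gap puts
above every coefficient of level at least [n]. *)
Lemma stage_full_levels n : gap n -> G (size (full_levels n)) = approx (full_levels n).
Proof.
move=> gn; rewrite -[X in G X]add0n -[RHS](_ : approx ([::] ++ full_levels n) = _) //.
apply: stage; first exact: valid_full_levels.
  by apply/funext => x; rewrite approx0 G_run.1.
move=> S l i _ sS nS pk; have [hi h] := picks_bound pk.
rewrite mem_full_levels hi andbT ltnNge; apply/negP => nl.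
apply: nS => -[k j]; rewrite mem_full_levels => /andP[kn hj].
apply: contraT => kjS; have := h k j hj.
rewrite {1}/residual (negbTE kjS) /residual (negbTE (picks_notin pk)) leNgt.
by rewrite gn // kn.
Qed.

End Stages.

(** On the cell [(1, 0)] of a level [k] in [K], the Haar functions of the levels
above are positive, and so is the one of index 1 at level [k]; one of them is at
least [4^(k-1)], so this cell contributes [kappa / 16] to the norm. *)
Lemma haar_sum_norm_ge Y K (kappa : R) : 0 <= kappa -> uniq K ->
  (forall q, q \in Y -> c q.1 q.2 = kappa) ->
  (forall k q, k \in K -> q \in Y -> q.1 = k -> q.2 = 1%N) ->
  (forall k, k \in K -> exists2 l, (l <= k <= l.+1)%N & (l, 1%N) \in Y) ->
  ((kappa / 16 * (size K)%:R)%:E <=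
    \int[mu]_(x in @usquare R) `|haar_sum Y x|%:E)%E.
Proof.
move=> k0 uK cY Y1 YK.
pose w (k : nat) a b := if a && ~~ b then kappa / 16 else 0.
pose L x := \sum_(k <- K) cell_step w k x.
have iL : inL1 L by apply: inL1_sum => k; exact: inL1_cell_step.
have eL : \int[mu]_(x in @usquare R) L x = kappa / 16 * (size K)%:R.
  rewrite integral_inL1_sum; last by move=> k; exact: inL1_cell_step.
  under eq_bigr do rewrite integral_cell_step /sum3 /w /= add0r addr0.
  by rewrite big_const_seq count_predT iter_addr_0 mulr_natr.
have pos x : 0 <= L x.
  apply: sumr_ge0 => k _; apply: mulr_ge0; first exact: exprn_ge0.
  rewrite /sum3 /w /= !mul0r add0r addr0 indicE.
  by apply: mulr_ge0; [exact: divr_ge0|exact: ler0n].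
have dom x : L x <= `|haar_sum Y x|.
  have [[k kK h]|no] := pselect (exists2 k, k \in K & box k.+1 true false x); last first.
    rewrite /L big_seq big1 // => k kK; rewrite /cell_step /sum3 /w /= !mul0r add0r addr0.
    by rewrite indicE memNset ?mulr0 // => h; apply: no; exists k.
  have e k' : cell_step w k' x = (k' == k)%:R * (4 ^+ k.+1 * (kappa / 16)).
    by rewrite (cell_step_in w k' (isT : true || false) h).
  rewrite /L (bigD1_seq k) //= big1 => [|k' /negbTE k'k]; last by rewrite e k'k mul0r.
  rewrite e eqxx mul1r addr0; apply: le_trans (ler_norm _).
  have t0 q : q \in Y -> 0 <= c q.1 q.2 * haar (Q q.1) q.2 x.
    move=> qY; rewrite cY // (haar_cell q.1 q.2 (isT : true || false) h).
    apply: mulr_ge0 => //; rewrite /corner_haar_value; case: ifP => // _.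
    case: eqVneq => [kq|_]; last exact: exprn_ge0.
    by rewrite (Y1 k) // /sgn /= expr0 !mulr1 exprn_ge0.
  have [l /andP[lk kl] lY] := YK k kK.
  rewrite /haar_sum (big_rem _ lY) /=; apply: (@le_trans _ _ (c l 1 * haar (Q l) 1 x)).
    rewrite (cY _ lY) (haar_cell l 1 (isT : true || false) h) /corner_haar_value ltnNge lk /=.
    rewrite /sgn /= expr0 !mulr1 if_same.
    have h4 : 4 ^+ k * kappa <= 4 ^+ l.+1 * kappa.
      by rewrite ler_wpM2r // ler_eXn2l // ltr1n.
    by move: h4; rewrite !exprS; lra.
  rewrite lerDl big_seq sumr_ge0 // => q /mem_rem; exact: t0.
have -> : (kappa / 16 * (size K)%:R)%:E = (\int[mu]_(x in @usquare R) (L x)%:E)%E.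
  by rewrite -eL fineK //; apply: integrable_fin_num iL; exact: measurable_usquare.
apply: ge0_le_integral.
- exact: measurable_usquare.
- by move=> x _; rewrite lee_fin.
- exact: measurable_int iL.
- apply/measurable_EFinP; apply: measurableT_comp => //.
  by apply/measurable_EFinP; exact: measurable_int (inL1_haar_sum Y).
- by move=> x _; rewrite lee_fin.
Qed.

(** The two approximants before and after the forced selections are at distance
at least [delta], arbitrarily late in the run. *)
Lemma run_not_cvg (delta : R) : 0 < delta ->
  (forall p, exists n Y, [/\ (p <= n)%N, gap n, forced (full_levels n) Y
     & (delta%:E <= \int[mu]_(x in @usquare R) `|haar_sum Y x|%:E)%E]) ->
  forall G, wga_run s t f G -> ~ exists g, inL1 g /\ cvg_L1 G g.
Proof.
move=> d0 H G run [g [gL1]] /fine_cvgP[hfin hcvg].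
have d2 : 0 < delta / 2 by rewrite divr_gt0.
have [N1 _ h1] := hfin.
have [N2 _ h2] := cvgr_lt 0 hcvg (delta / 2) d2.
have [n [Y [pn gn fY dn]]] := H (maxn N1 N2).
pose m := size (full_levels n).
have em : G m = approx (full_levels n) := stage_full_levels run gn.
have em' := stage_forced run fY em.
have small k : (maxn N1 N2 <= k)%N ->
    (\int[mu]_(x in @usquare R) `|G k x - g x|%:E < (delta / 2)%:E)%E.
  rewrite geq_max => /andP[k1 k2]; have := h2 k k2; have := h1 k k1.
  by move=> /= fk; rewrite -lte_fin fineK.
have mm : (maxn N1 N2 <= m)%N by rewrite /m size_full_levels; lia.
have s1 := small m mm; have s2 := small (m + size Y)%N (leq_trans mm (leq_addr _ _)).
have L k : inL1 (G k) -> measurable_fun (@usquare R)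
    (fun x : measurableTypeR R * measurableTypeR R => `|G k x - g x|%:E).
  move=> hk; apply/measurable_EFinP; apply: measurableT_comp => //.
  by apply/measurable_EFinP; exact: measurable_int (inL1B hk gL1).
have L1 : inL1 (G m) by rewrite em; exact: inL1_approx.
have L2 : inL1 (G (m + size Y)%N) by rewrite em'; exact: inL1_approx.
have : (delta%:E <= \int[mu]_(x in @usquare R)
    (`|G (m + size Y)%N x - g x|%:E + `|G m x - g x|%:E))%E.
  apply: (le_trans dn); apply: ge0_le_integral.
  - exact: measurable_usquare.
  - by move=> x _; rewrite lee_fin.
  - apply/measurable_EFinP; apply: measurableT_comp => //.
    by apply/measurable_EFinP; exact: measurable_int (inL1_haar_sum Y).
  - by apply: emeasurable_funD; exact: L.
  - move=> x _; rewrite -EFinD lee_fin.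
    have -> : haar_sum Y x = (G (m + size Y)%N x - g x) - (G m x - g x).
      by rewrite em em' /approx /haar_sum big_cat /=; ring.
    exact: ler_normB.
rewrite ge0_integralD //; [|exact: measurable_usquare|exact: L|exact: L].
move=> /le_lt_trans /(_ (lteD s2 s1)).
by rewrite -EFinD lte_fin -splitr ltxx.
Qed.

End Run.

(** * Functions with prescribed corner masses *)
Section SkewedMass.
Context {R : realType}.
Implicit Types (n k l : nat) (i j : nat).

(** The corner coefficients of a function whose integral over [Q k] is [m k], the
difference [m k - m k.+1] being shared equally between the three cells up to a
skewness [2 d, -d, -d]. *)
Definition base_coef (m d : nat -> R) k j : R :=
  (4 * m k.+1 - m k) / 3 + (if j == 1%N then 4 else -2) * d k.

Lemma exists_base_coef (m d phi : nat -> R) :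
  (forall k, `|m k - m k.+1| + 4 * `|d k| <= phi k - phi k.+1) ->
  (forall k, 0 <= phi k) -> m @ \oo --> (0 : R) ->
  exists f, [/\ inL1 f,
    forall k j, haar_index j -> coef (Q k) j f = base_coef m d k j &
    forall I j, haar_index j -> ~~ corner I -> coef I j f = 0].
Proof.
move=> hphi phi0 m0.
pose w k (a b : bool) := (m k - m k.+1) / 3 + (if a && ~~ b then 2 else -1) * d k.
have hw k : sum3 (fun a b => `|w k a b|) <= phi k - phi k.+1.
  apply: le_trans (hphi k); rewrite /sum3 /w /=.
  set u := m k - m k.+1; move: (d k) => e.
  have h1 := ler_normD (u / 3) (2 * e); have h2 := ler_normD (u / 3) (-1 * e).
  have e3 : `|u / 3| = `|u| / 3 by rewrite normrM [`|3^-1|]ger0_norm.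
  have e2 : `|2 * e| = 2 * `|e| by rewrite normrM [`|2|]ger0_norm.
  have e1 : `|-1 * e| = `|e| by rewrite mulN1r normrN.
  rewrite e3 e2 in h1; rewrite e3 e1 in h2.
  by lra.
have [f [f1 cf]] := exists_cellular hw phi0.
exists f; split => //; last by move=> I j hj cI; exact: coef_off_corner f1 cf hj cI.
move=> k j hj; rewrite (coef_corner (m := m) f1 cf) //; last first.
  by move=> k'; rewrite /sum3 /w /=; field.
rewrite /base_coef /sum3 /w /sgn.
by case/haar_indexP: hj => -> /=; rewrite ?expr0 ?expr1; field.
Qed.

End SkewedMass.

(** * Blocks of levels with geometrically decreasing amplitudes *)
Section Scale.
Context {R : realType}.
Implicit Types (n k l p : nat) (i j : nat).
Variables (t : R) (b : nat).
Hypothesis t_gt0 : 0 < t.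
Hypothesis t_le1 : t <= 1.
Hypothesis b_large : 32 <= b%:R * t ^+ 2.

(** The common order of magnitude of the coefficients at level [k], constant on
the blocks [b^p <= k < b^(p+1)]. *)
Definition amp k : R := b%:R ^- trunc_log b k.

(** Holds at the last level of a block. *)
Definition turning k : bool := trunc_log b k.+1 != trunc_log b k.

Lemma b_ge32 : (32 <= b)%N.
Proof.
rewrite -(ler_nat R); apply: le_trans b_large _.
by rewrite ler_piMr // expr_le1 // ltW.
Qed.

Lemma b_gt1 : (1 < b)%N. Proof. exact: leq_trans b_ge32. Qed.

Lemma b_pos : (0 : R) < b%:R.
Proof. by rewrite ltr0n ltnW // b_gt1. Qed.

Lemma bR_ge32 : (32 : R) <= b%:R.
Proof. by rewrite ler_nat b_ge32. Qed.

Lemma bt_ge32 : 32 <= b%:R * t.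
Proof.
apply: le_trans b_large _; rewrite ler_wpM2l ?ler0n // expr2.
by rewrite ler_piMl // ltW.
Qed.

Lemma amp_gt0 k : 0 < amp k.
Proof. by rewrite invr_gt0 exprn_gt0 // b_pos. Qed.

Lemma amp_le1 k : amp k <= 1.
Proof. by rewrite invf_le1 ?exprn_gt0 ?b_pos // exprn_ege1 // ler1n ltnW // b_gt1. Qed.

Lemma amp_steady k : ~~ turning k -> amp k.+1 = amp k.
Proof. by rewrite /turning negbK /amp => /eqP->. Qed.

Lemma amp_turning k : turning k -> amp k.+1 = amp k / b%:R.
Proof.
rewrite /turning => h; have [h1] : trunc_log b k.+1 = (trunc_log b k).+1.
  apply/eqP; rewrite eqn_leq; apply/andP; split; last first.
    by rewrite ltn_neqAle eq_sym h leq_trunc_log.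
  have e : (k.+1 <= b ^ (trunc_log b k).+1)%N by exact: trunc_log_ltn b_gt1.
  by apply: leq_trans (leq_trunc_log _ e) _; rewrite trunc_expnK // b_gt1.
by rewrite /amp h1 exprS invfM mulrC.
Qed.

Lemma amp_block k p : (b ^ p <= k < b ^ p.+1)%N -> amp k = b%:R ^- p.
Proof. by move=> h; rewrite /amp (trunc_log_eq b_gt1 h). Qed.

Lemma turning_block k p : (b ^ p <= k < b ^ p.+1)%N ->
  turning k = (k.+1 == b ^ p.+1)%N.
Proof.
move=> h; rewrite /turning (trunc_log_eq b_gt1 h); move/andP: h => [h1 h2].
have [e|ne] := eqVneq k.+1 (b ^ p.+1)%N.
  by rewrite e trunc_expnK ?b_gt1 // neq_ltn ltnSn orbT.
rewrite (@trunc_log_eq b p) ?b_gt1 ?eqxx //.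
by rewrite (leq_trans h1) // ltn_neqAle ne.
Qed.

Lemma amp_after k p : (b ^ p <= k)%N -> amp k <= b%:R ^- p.
Proof.
move=> h; rewrite lef_pV2 ?posrE ?exprn_gt0 ?b_pos // ler_eXn2l.
  exact: trunc_log_max b_gt1 h.
by rewrite ltr1n b_gt1.
Qed.

Lemma amp_before k p : (k < b ^ p.+1)%N -> b%:R ^- p <= amp k.
Proof.
move=> h; rewrite lef_pV2 ?posrE ?exprn_gt0 ?b_pos // ler_eXn2l.
  case: k h => [|k] h; first by rewrite trunc_log0.
  rewrite -ltnS -(ltn_exp2l _ _ b_gt1); apply: leq_ltn_trans h.
  exact: trunc_logP b_gt1 _.
by rewrite ltr1n b_gt1.
Qed.

Lemma amp_bound k : amp k <= b%:R / k.+1%:R.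
Proof.
rewrite ler_pdivlMr ?ltr0Sn // -ler_pdivlMl ?amp_gt0 // invrK mulrC -exprS.
by rewrite -natrX ler_nat; exact: trunc_log_ltn b_gt1.
Qed.

Lemma amp_cvg : amp @ \oo --> (0 : R).
Proof.
have h : (fun k => b%:R / k.+1%:R : R) @ \oo --> (0 : R).
  rewrite -[X in _ --> X](mulr0 b%:R); apply: cvgM; first exact: cvg_cst.
  exact: cvg_harmonic.
apply: (squeeze_cvgr _ (cvg_cst 0) h); apply: nearW => k.
by apply/andP; split; [exact/ltW/amp_gt0 | exact: amp_bound].
Qed.

(** Its decrease bounds the variation of the mass in both constructions: the first
term pays for the jumps at the ends of the blocks, the second one, of decrease
at least [(b / k.+1)^2], for the small terms inside them. *)
Definition potential k : R := 4 * amp k + 2 * b%:R ^+ 2 / k.+1%:R.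

Lemma potential_ge0 k : 0 <= potential k.
Proof.
by rewrite /potential addr_ge0 // ?mulr_ge0 ?divr_ge0 ?mulr_ge0 ?exprn_ge0 // ltW // amp_gt0.
Qed.

(** Uses [amp k <= b / k.+1] and the telescoping of [1 / (k (k + 1))]. *)
Lemma potential_steady k : amp k ^+ 2 <= potential k - potential k.+1.
Proof.
have h1 : amp k.+1 <= amp k.
  have [/amp_turning->|/amp_steady->//] := boolP (turning k).
  rewrite ler_pdivrMr ?b_pos // ler_peMr ?ltW ?amp_gt0 //.
  by rewrite ltr1n b_gt1.
have z : (0 : R) < k.+1%:R by rewrite ltr0Sn.
have h2 : amp k ^+ 2 <= (b%:R / k.+1%:R) ^+ 2.
  apply: lerXn2r; rewrite ?nnegrE ?divr_ge0 //; last exact: amp_bound.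
  exact/ltW/amp_gt0.
suff h3 : (b%:R / k.+1%:R) ^+ 2 <= 2 * b%:R ^+ 2 / k.+1%:R - 2 * b%:R ^+ 2 / k.+2%:R :> R.
  apply: (le_trans h2); apply: (le_trans h3); rewrite /potential.
  by move: (_ / k.+1%:R) (_ / k.+2%:R) => u v; lra.
rewrite -[k.+2%:R]natr1; have z1 : (1 : R) <= k.+1%:R by rewrite ler1n.
move: (k.+1%:R : R) z z1 => y y0 y1; rewrite -subr_ge0.
have -> : 2 * b%:R ^+ 2 / y - 2 * b%:R ^+ 2 / (y + 1) - (b%:R / y) ^+ 2 =
    b%:R ^+ 2 * ((y - 1) / (y ^+ 2 * (y + 1))).
  by field; rewrite !gt_eqF //; lra.
by rewrite mulr_ge0 ?exprn_ge0 // divr_ge0 ?mulr_ge0 ?exprn_ge0 //; lra.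
Qed.

Lemma potential_turning k : turning k -> 3 * amp k <= potential k - potential k.+1.
Proof.
move=> /amp_turning e; rewrite /potential e.
have h : 4 * (amp k / b%:R) <= amp k.
  rewrite mulrA ler_pdivrMr ?b_pos // mulrC ler_wpM2l ?ltW ?amp_gt0 //.
  by have := bR_ge32; lra.
have : 2 * b%:R ^+ 2 / k.+2%:R <= 2 * b%:R ^+ 2 / k.+1%:R :> R.
  by rewrite ler_wpM2l ?mulr_ge0 ?exprn_ge0 // lef_pV2 ?posrE ?ltr0Sn // ler_nat.
by move: (_ / k.+1%:R) (_ / k.+2%:R) => u v; lra.
Qed.

(** From one block to the next the amplitude is divided by [b], which exceeds
[hi / (t * lo)]. *)
Lemma gap_block (c : nat -> nat -> R) (lo hi : R) p :
  (forall k j, haar_index j -> lo * amp k <= `|c k j| <= hi * amp k) ->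
  0 < hi -> hi < t * lo * b%:R -> gap c t (b ^ p.+1).
Proof.
move=> hc hi0 hlo k k' j j' /andP[kp pk] hj hj'.
have /andP[h1 _] := hc k j hj; have /andP[_ h2] := hc k' j' hj'.
apply: (le_lt_trans h2); apply: (lt_le_trans (y := t * (lo * amp k))); last first.
  by rewrite ler_pM2l.
have ha := amp_after pk; have hb := amp_before kp.
apply: (@le_lt_trans _ _ (hi * (b%:R ^- p / b%:R))).
  by apply: ler_wpM2l; [exact: ltW | rewrite -invfM -exprSr].
apply: (@lt_le_trans _ _ (t * (lo * b%:R ^- p))).
  have q0 : (0 : R) < b%:R ^- p by rewrite invr_gt0 exprn_gt0 // b_pos.
  move: (b%:R ^- p : R) q0 => q q0.
  have -> : hi * (q / b%:R) = hi / b%:R * q by ring.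
  by rewrite mulrA ltr_pM2r // ltr_pdivrMr // b_pos.
apply: ler_wpM2l; first exact: ltW.
apply: ler_wpM2l hb.
have : 0 < t * lo * b%:R by exact: lt_trans hlo.
by rewrite pmulr_lgt0 ?b_pos // pmulr_rgt0 // => /ltW.
Qed.

Lemma amp_dom_cvg (c : nat -> nat -> R) (hi : R) :
  (forall k j, haar_index j -> `|c k j| <= hi * amp k) ->
  forall e, 0 < e -> exists N, forall k j, (N <= k)%N -> haar_index j -> `|c k j| < e.
Proof.
move=> hc e e0.
have h : (fun k => hi * amp k) @ \oo --> (0 : R).
  by rewrite -[X in _ --> X](mulr0 hi); apply: cvgM; [exact: cvg_cst|exact: amp_cvg].
have [N _ hN] := cvgr_lt 0 h e e0.
by exists N => k j Nk hj; apply: le_lt_trans (hc k j hj) _; exact: hN.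
Qed.

End Scale.

(** * Divergence from the behaviour inside each block *)
Section Counterexamples.
Context {R : realType}.
Implicit Types (n k l p : nat) (i j : nat).
Variables (s t : R) (b : nat).
Hypothesis t_gt0 : 0 < t.
Hypothesis t_le_s : t <= s.
Hypothesis s_le1 : s <= 1.
Hypothesis b_large : 32 <= b%:R * t ^+ 2.

Let t_le1 : t <= 1 := le_trans t_le_s s_le1.
Notation a := (@amp R b).

(** The common part of the two cases: [Y] is what is selected first in the block
of number [p.+1], [kappa] the value of its coefficients, and [K] the levels on
whose cells the norm of the sum over [Y] is collected. *)
Lemma base_diverges (m d : nat -> R) (lo hi : R) :
  (forall k, `|m k - m k.+1| + 4 * `|d k| <= potential b k - potential b k.+1) ->
  m @ \oo --> (0 : R) ->
  (forall k j, haar_index j -> lo * a k <= `|base_coef m d k j| <= hi * a k) ->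
  0 < lo -> 0 < hi -> hi < t * lo * b%:R ->
  (forall p, exists Y K kappa, [/\ 0 <= kappa, uniq K, t <= kappa * (size K)%:R
     & forced (base_coef m d) s t (full_levels (b ^ p.+1)) Y] /\
     [/\ forall q, q \in Y -> base_coef m d q.1 q.2 = kappa,
         forall k q, k \in K -> q \in Y -> q.1 = k -> q.2 = 1%N
       & forall k, k \in K -> exists2 l, (l <= k <= l.+1)%N & (l, 1%N) \in Y]) ->
  exists f : R * R -> R,
    [/\ inL1 f,
        exists G : nat -> R * R -> R, wga_run s t f G
      & forall G : nat -> R * R -> R, wga_run s t f G ->
          ~ exists g : R * R -> R, inL1 g /\ cvg_L1 G g].
Proof.
move=> hphi m0 hc lo0 hi0 hlo H; set c := base_coef m d in hc H.
have [f [f1 fc fo]] := exists_base_coef hphi (potential_ge0 t_gt0 t_le1 b_large) m0.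
have cc := amp_dom_cvg t_gt0 t_le1 b_large (fun k j hj => proj2 (andP (hc k j hj))).
have c0 k j : haar_index j -> c k j != 0.
  move=> hj; have /andP[h _] := hc k j hj; rewrite -normr_gt0; apply: lt_le_trans h.
  exact: mulr_gt0 lo0 (amp_gt0 t_gt0 t_le1 b_large k).
exists f; split => //.
  exact: (run_exists f1 fc fo cc c0 t_gt0 t_le_s s_le1).
apply: (run_not_cvg f1 fc fo c0 t_gt0 t_le_s s_le1 (delta := t / 16)).
  by rewrite divr_gt0.
move=> p; have [Y [K [kappa [[k0 uK tK fY] [h1 h2 h3]]]]] := H p.
exists (b ^ p.+1)%N, Y; split => //.
- by apply: ltnW; apply: leq_trans (ltn_expl _ (b_gt1 t_gt0 t_le1 b_large)).
- exact: gap_block hc hi0 hlo.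
- apply: le_trans (haar_sum_norm_ge k0 uK h1 h2 h3).
  by rewrite lee_fin mulrAC ler_wpM2r ?invr_ge0.
Qed.

End Counterexamples.

(** * The case of equal parameters *)
Section EqualParameters.
Context {R : realType}.
Implicit Types (n k l p : nat) (i j : nat).
Variables (t : R) (b : nat).
Hypothesis t_gt0 : 0 < t.
Hypothesis t_le1 : t <= 1.
Hypothesis b_large : 32 <= b%:R * t ^+ 2.
Notation a := (@amp R b).
Let ta k : R := t * a k.
Let taa k : R := t * a k ^+ 2.

(** The coefficient of index 1 is the mass plus [4 * skew_eq k], which makes it
exactly [t * a k] at the levels that do not end a block. *)
Definition mass_eq k : R := t * a k - t * a k ^+ 2 / 2.

(** At the end of a block the skewness is chosen so that the coefficient of index 1
is the amplitude of the block, hence its maximal coefficient. *)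
Definition skew_eq k : R :=
  if turning b k then (a k - (4 * mass_eq k.+1 - mass_eq k) / 3) / 4
  else t * a k ^+ 2 / 8.

Definition coef_eq := base_coef mass_eq skew_eq.

Let a0 k : 0 < a k := amp_gt0 t_gt0 t_le1 b_large k.

Lemma taa_bounds k : 0 < taa k <= ta k /\ 0 < ta k <= a k.
Proof.
have h0 := a0 k; have h1 : a k <= 1 := amp_le1 t_gt0 t_le1 b_large k.
rewrite /taa /ta !mulr_gt0 ?exprn_gt0 //=; split.
  by apply: ler_wpM2l; [exact: ltW | rewrite expr2 ler_piMr // ltW].
by rewrite ler_piMl // ltW.
Qed.

Lemma mass_eq_turning k : turning b k -> 0 <= mass_eq k.+1 <= ta k / 32.
Proof.
move=> h; have [/andP[h1 h2] /andP[h3 _]] := taa_bounds k.+1.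
have e : ta k.+1 <= ta k / 32.
  rewrite /ta (amp_turning t_gt0 t_le1 b_large h) mulrA.
  apply: ler_wpM2l; first by rewrite mulr_ge0 // ltW.
  rewrite lef_pV2 ?posrE //.
    exact: bR_ge32 t_gt0 t_le1 b_large.
  exact: b_pos t_gt0 t_le1 b_large.
by rewrite /mass_eq -/(ta k.+1) -/(taa k.+1); apply/andP; split; lra.
Qed.

Lemma coef_eq1 k : coef_eq k 1 = if turning b k then a k else ta k.
Proof.
rewrite /coef_eq /base_coef /skew_eq; case: ifPn => h; first by rewrite /=; field.
by rewrite /mass_eq (amp_steady h) /ta /=; field.
Qed.

Lemma coef_eq_steady k j : ~~ turning b k -> haar_index j -> j != 1%N ->
  ta k / 4 <= coef_eq k j < ta k.
Proof.
move=> h hj j1; have [/andP[h1 h2] /andP[h3 h4]] := taa_bounds k.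
rewrite /coef_eq /base_coef /skew_eq /mass_eq (negbTE h) (negbTE j1) (amp_steady h).
by move: h1 h2 h3 h4; rewrite /ta /taa => *; apply/andP; split; lra.
Qed.

Lemma coef_eq_turning k j : turning b k -> haar_index j -> j != 1%N ->
  - a k <= coef_eq k j <= - (a k / 2).
Proof.
move=> h hj j1; have [/andP[h1 h2] /andP[h3 h4]] := taa_bounds k.
have /andP[h5 h6] := mass_eq_turning h.
rewrite /coef_eq /base_coef /skew_eq h (negbTE j1).
move: h5 h6; move: (mass_eq k.+1) => m'; rewrite /mass_eq; move: h1 h2 h3 h4.
by rewrite /ta /taa => *; apply/andP; split; lra.
Qed.

Lemma coef_eq_bounds k j : haar_index j ->
  t / 4 * a k <= `|coef_eq k j| <= 1 * a k.
Proof.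
move=> hj; have [/andP[h1 h2] /andP[h3 h4]] := taa_bounds k.
rewrite mul1r mulrAC -/(ta k).
have [->|j1] := eqVneq j 1%N.
  by rewrite coef_eq1; case: ifP => _; rewrite gtr0_norm //; apply/andP; split; lra.
have [h|h] := boolP (turning b k).
  have /andP[h5 h6] := coef_eq_turning h hj j1.
  by rewrite ler0_norm; [apply/andP; split; lra | lra].
have /andP[h5 h6] := coef_eq_steady h hj j1.
by rewrite ger0_norm; [apply/andP; split; lra | lra].
Qed.

Lemma coef_eq_le k j : haar_index j -> `|coef_eq k j| <= a k.
Proof. by move=> /(coef_eq_bounds k)/andP[_]; rewrite mul1r. Qed.

Lemma mass_eq_variation k :
  `|mass_eq k - mass_eq k.+1| + 4 * `|skew_eq k| <= potential b k - potential b k.+1.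
Proof.
have [/andP[h1 h2] /andP[h3 h4]] := taa_bounds k.
have [h|h] := boolP (turning b k).
  apply: le_trans (potential_turning t_gt0 t_le1 b_large h).
  have /andP[h5 h6] := mass_eq_turning h.
  rewrite /skew_eq h; move: h5 h6; move: (mass_eq k.+1) => m'.
  rewrite /mass_eq -/(ta k) -/(taa k) => h5 h6.
  rewrite !ger0_norm; lra.
apply: le_trans (potential_steady t_gt0 t_le1 b_large k).
rewrite /skew_eq (negbTE h) /mass_eq (amp_steady h) subrr normr0 add0r.
rewrite -/(taa k) ger0_norm; last lra.
have : taa k <= a k ^+ 2 by rewrite /taa ler_piMl // exprn_ge0 // ltW.
have : 0 < a k ^+ 2 by rewrite exprn_gt0.
by lra.
Qed.

Lemma mass_eq_cvg : mass_eq @ \oo --> (0 : R).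
Proof.
have h := @amp_cvg R t b t_gt0 t_le1 b_large.
have -> : (0 : R) = t * 0 - t * 0 ^+ 2 / 2 by ring.
apply: cvgB; first by apply: cvgM; [exact: cvg_cst|exact: h].
apply: cvgM; last exact: cvg_cst.
by apply: cvgM; [exact: cvg_cst|rewrite expr2; under eq_fun do rewrite expr2; exact: cvgM].
Qed.

Definition column n len : seq (nat * nat) := [seq (k, 1%N) | k <- iota n len].

Lemma mem_column n len k j :
  ((k, j) \in column n len) = (n <= k < n + len)%N && (j == 1%N).
Proof.
apply/mapP/andP => [[k' + [-> ->]]|[h /eqP->]]; first by rewrite mem_iota.
by exists k => //; rewrite mem_iota.
Qed.

Lemma valid_column n len : valid (full_levels n ++ column n len).
Proof.
apply/andP; split; last first.
  rewrite all_cat; case/andP: (valid_full_levels n) => _ ->.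
  by apply/allP => -[k j]; rewrite mem_column => /andP[_ /eqP->].
rewrite cat_uniq; case/andP: (valid_full_levels n) => -> _ /=; apply/andP; split.
  apply/hasPn => -[k j]; rewrite mem_column mem_full_levels => /andP[/andP[h _] _].
  by rewrite ltnNge h.
by rewrite map_inj_uniq ?iota_uniq // => x y [].
Qed.

(** While [len] coefficients of index 1 have been removed, the maximum is attained
between level [n + len] and the end of the block; the chain above it stops at
level [n + len], as the remaining coefficients of the levels above are below the
threshold [t * al].  At that level only the index 1 meets the threshold. *)
Lemma column_forced p len : (b ^ p.+1 + len < b ^ p.+2)%N ->
  forced coef_eq t t (full_levels (b ^ p.+1)) (column (b ^ p.+1) len).
Proof.
set n := (b ^ p.+1)%N; have b1 := b_gt1 t_gt0 t_le1 b_large.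
elim: len => [|len IH] hlen; first exact: forced_nil.
have eC : column n len.+1 = column n len ++ [:: ((n + len)%N, 1%N)].
  by rewrite /column -[len.+1]addn1 iotaD map_cat.
rewrite eC; apply: forced_cat; first by apply: IH; lia.
  by rewrite -eC; exact: valid_column.
move=> S l i sX sS nS pk.
pose al : R := b%:R ^- p.+1.
have ablk k : (n <= k < b ^ p.+2)%N -> a k = al by exact: (amp_block t_gt0 t_le1 b_large).
have tblk k : (n <= k < b ^ p.+2)%N -> turning b k = (k.+1 == b ^ p.+2)%N.
  exact: (turning_block t_gt0 t_le1 b_large).
have al0 : 0 < al by rewrite invr_gt0 exprn_gt0 // (b_pos t_gt0 t_le1 b_large).
have nlin : ((n + len)%N, 1%N) \notin S.
  by apply/negP => h; apply: nS => q; rewrite inE => /eqP->.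
have inS k j : (n + len <= k)%N -> (k, j) \notin S.
  move=> hk; apply/negP => kjS; have := sS _ kjS.
  rewrite !mem_cat mem_full_levels mem_column inE xpair_eqE.
  case/orP => [/orP[/andP[h _]|/andP[/andP[_ h] _]]|/andP[/eqP e /eqP e1]]; try lia.
  by subst k j; rewrite kjS in nlin.
have ton k : (n + len <= k < b ^ p.+2)%N -> t * al <= `|residual coef_eq S k 1|.
  move=> /andP[k1 k2]; have kb : (n <= k < b ^ p.+2)%N by lia.
  rewrite /residual (negbTE (inS _ _ k1)) coef_eq1 /ta (ablk _ kb).
  by case: ifP => _; rewrite gtr0_norm ?mulr_gt0 // ler_piMl // ltW.
have low k j : haar_index j -> (k < n + len)%N -> `|residual coef_eq S k j| < t * al.
  move=> hj kn; rewrite /residual; case: ifPn => kjS; first by rewrite normr0 mulr_gt0.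
  have nX : (k, j) \notin full_levels n ++ column n len by apply: contra kjS; exact: sX.
  move: nX; rewrite mem_cat mem_full_levels mem_column hj andbT negb_or => /andP[h1 h2].
  have kb : (n <= k < b ^ p.+2)%N by lia.
  have j1 : j != 1%N by apply: contra h2 => ->; rewrite andbT; lia.
  have st : ~~ turning b k by rewrite tblk //; lia.
  have /andP[h3 h4] := coef_eq_steady st hj j1.
  have [_ /andP[h5 _]] := taa_bounds k.
  by rewrite ger0_norm; [rewrite -(ablk _ kb) | lra].
have far k j : haar_index j -> (b ^ p.+2 <= k)%N -> `|residual coef_eq S k j| < t * al.
  move=> hj kn; rewrite /residual; case: ifP => _; first by rewrite normr0 mulr_gt0.
  apply: le_lt_trans (coef_eq_le k hj) _.
  apply: le_lt_trans (amp_after t_gt0 t_le1 b_large kn) _.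
  rewrite exprSr invfM -/al mulrC ltr_pM2r // invf_plt ?posrE ?(b_pos t_gt0 t_le1 b_large) //.
  rewrite -(ltr_pM2r t_gt0) mulVf ?gt_eqF //.
  by have := bt_ge32 t_gt0 t_le1 b_large; lra.
have [k [j [[hj mx] [lk ch] lmin [hi adm]]]] := pk.
have big : al <= `|residual coef_eq S k j|.
  pose k1 := (b ^ p.+2).-1; have e1 : k1.+1 = (b ^ p.+2)%N by rewrite /k1; lia.
  have h : (n <= k1 < b ^ p.+2)%N by lia.
  (* The last level of the block still carries its coefficient al. *)
  have hS : (k1, 1%N) \notin S by apply: inS; lia.
  have := mx k1 1%N isT; rewrite {1}/residual (negbTE hS) coef_eq1.
  by rewrite tblk // e1 eqxx ablk // gtr0_norm.
have tal : t * al <= al by rewrite ler_piMl // ltW.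
have kin : (n + len <= k < b ^ p.+2)%N.
  apply/andP; split; rewrite leqNgt; apply/negP => h.
    by have := low k j hj h; lra.
  have := far k j hj h; lra.
have leq : (l <= n + len)%N.
  apply: lmin; split; first by lia.
  move=> n' hn'; exists 1%N => //.
  apply: (@le_trans _ _ (t * al)); last by apply: ton; lia.
  rewrite ler_pM2l // /residual; case: ifP => _; first by rewrite normr0 ltW.
  by apply: le_trans (coef_eq_le k hj) _; rewrite ablk //; lia.
have leq' : (n + len <= l)%N.
  rewrite leqNgt; apply/negP => h; have [|i' hi' h'] := ch l; first by rewrite leqnn.
  have := low l i' hi' h; rewrite ltNge => /negP; apply; apply: le_trans h'.
  by rewrite ler_pM2l.
have el : l = (n + len)%N by lia.
rewrite inE el xpair_eqE eqxx /=; apply: contraT => i1.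
have lb : (n <= l < b ^ p.+2)%N by lia.
have st : ~~ turning b l by rewrite tblk //; lia.
have /andP[h3 h4] := coef_eq_steady st hi i1.
have [_ /andP[h5 _]] := taa_bounds l.
have h6 : t * al <= `|residual coef_eq S l 1| by apply: ton; rewrite -el leqnn; case/andP: lb.
have := adm 1%N isT; rewrite divff ?gt_eqF // mul1r => h7.
have : `|residual coef_eq S l i| < t * al.
  rewrite /residual; case: ifP => _; first by rewrite normr0 mulr_gt0.
  by rewrite ger0_norm; [rewrite -(ablk _ lb) | lra].
by lra.
Qed.

Lemma equal_parameters_diverge : exists f : R * R -> R,
  [/\ inL1 f,
      exists G : nat -> R * R -> R, wga_run t t f G
    & forall G : nat -> R * R -> R, wga_run t t f G ->
        ~ exists g : R * R -> R, inL1 g /\ cvg_L1 G g].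
Proof.
apply: (base_diverges t_gt0 (lexx t) t_le1 b_large mass_eq_variation mass_eq_cvg
  coef_eq_bounds).
- by rewrite divr_gt0.
- exact: ltr01.
- by move: b_large; rewrite expr2; lra.
move=> p; set n := (b ^ p.+1)%N; have b1 := b_ge32 t_gt0 t_le1 b_large.
have n0 : (0 < n)%N by rewrite expn_gt0 (leq_trans _ b1).
have nn : (32 * n <= b ^ p.+2)%N by rewrite [(b ^ _.+1)%N]expnS leq_mul2r b1 orbT.
have al0 : (0 : R) < b%:R ^- p.+1 by rewrite invr_gt0 exprn_gt0 // (b_pos t_gt0 t_le1 b_large).
(* A small part of the block is enough: n of its levels make kappa * n equal to t. *)
exists (column n n), (iota n n), (t * b%:R ^- p.+1); split; split.
- by rewrite mulr_ge0 // ltW.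
- exact: iota_uniq.
- rewrite size_iota natrX -mulrA mulVf ?mulr1 //.
  by rewrite expf_neq0 // gt_eqF // (b_pos t_gt0 t_le1 b_large).
- by apply: column_forced; rewrite -/n; lia.
- move=> [k j]; rewrite mem_column => /andP[/andP[h1 h2] /eqP->] /=.
  have kb : (n <= k < b ^ p.+2)%N by rewrite h1; lia.
  rewrite -/coef_eq coef_eq1 (turning_block t_gt0 t_le1 b_large kb).
  rewrite /ta (amp_block t_gt0 t_le1 b_large kb).
  by case: eqP => // e; lia.
- by move=> k [k' j] _; rewrite mem_column => /andP[_ /eqP].
- by move=> k; rewrite mem_iota => h; exists k; rewrite ?leqnn ?leqnSn // mem_column h.
Qed.

End EqualParameters.

(** * The case where the first parameter is 1 *)
Section FullFirstParameter.
Context {R : realType}.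
Implicit Types (n k l p : nat) (i j : nat).
Variables (t : R) (b : nat).
Hypothesis t_gt0 : 0 < t.
Hypothesis t_le1 : t <= 1.
Hypothesis b_large : 32 <= b%:R * t ^+ 2.
Notation a := (@amp R b).

Let a0 k : 0 < a k := amp_gt0 t_gt0 t_le1 b_large k.

(** The coefficient at level [k] grows with the mass of level [k.+1] and decreases
with that of level [k]; raising the odd masses raises the even coefficients. *)
Definition mass_alt k : R := a k + (odd k)%:R * a k ^+ 2.

Definition coef_alt := base_coef mass_alt (fun=> 0).

Lemma mass_alt_bounds k : a k <= mass_alt k <= 2 * a k.
Proof.
have h : a k ^+ 2 <= a k.
  by rewrite expr2 ler_piMr ?(amp_le1 t_gt0 t_le1 b_large) // ltW.
have h' : 0 <= a k ^+ 2 by rewrite exprn_ge0 // ltW.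
have h0 := a0 k.
by rewrite /mass_alt; case: (odd k); rewrite ?mul1r ?mul0r; apply/andP; split; lra.
Qed.

Lemma mass_alt_turning k : turning b k -> 0 <= mass_alt k.+1 <= a k / 16.
Proof.
move=> h; have /andP[h1 h2] := mass_alt_bounds k.+1; have h3 := a0 k.+1.
have e : a k.+1 <= a k / 32.
  rewrite (amp_turning t_gt0 t_le1 b_large h); apply: ler_wpM2l; first exact: ltW.
  rewrite lef_pV2 ?posrE //; first exact: bR_ge32 t_gt0 t_le1 b_large.
  exact: b_pos t_gt0 t_le1 b_large.
by apply/andP; split; lra.
Qed.

Lemma coef_altE k j : coef_alt k j = (4 * mass_alt k.+1 - mass_alt k) / 3.
Proof. by rewrite /coef_alt /base_coef mulr0 addr0. Qed.

Lemma coef_alt_steady k j : ~~ turning b k ->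
  coef_alt k j = if odd k then a k - a k ^+ 2 / 3 else a k + 4 / 3 * a k ^+ 2.
Proof.
move=> h; rewrite coef_altE /mass_alt (amp_steady h) /=.
by case: (odd k); rewrite /=; field.
Qed.

Lemma coef_alt_turning k j : turning b k ->
  - (a k * 2 / 3) <= coef_alt k j <= - (a k / 4).
Proof.
move=> /mass_alt_turning/andP[h1 h2]; have /andP[h3 h4] := mass_alt_bounds k.
by have h5 := a0 k; rewrite coef_altE; apply/andP; split; lra.
Qed.

Lemma coef_alt_bounds k j : haar_index j ->
  1 / 4 * a k <= `|coef_alt k j| <= 3 * a k.
Proof.
move=> hj; have h0 := a0 k.
have [h|h] := boolP (turning b k).
  have /andP[h5 h6] := coef_alt_turning j h.
  by rewrite ler0_norm; [apply/andP; split; lra | lra].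
have h1 : a k ^+ 2 <= a k.
  by rewrite expr2 ler_piMr ?(amp_le1 t_gt0 t_le1 b_large) // ltW.
have h2 : 0 <= a k ^+ 2 by rewrite exprn_ge0 // ltW.
by rewrite coef_alt_steady //; case: ifP => _; rewrite ger0_norm;
  (try (apply/andP; split)); lra.
Qed.

Lemma mass_alt_variation k :
  `|mass_alt k - mass_alt k.+1| + 4 * `|0 : R| <= potential b k - potential b k.+1.
Proof.
rewrite normr0 mulr0 addr0; have h0 := a0 k.
have [h|h] := boolP (turning b k).
  apply: le_trans (potential_turning t_gt0 t_le1 b_large h).
  have /andP[h1 h2] := mass_alt_turning h; have /andP[h3 h4] := mass_alt_bounds k.
  by rewrite ger0_norm; lra.
apply: le_trans (potential_steady t_gt0 t_le1 b_large k).
rewrite /mass_alt (amp_steady h) /= opprD addrACA subrr add0r -mulrBl normrM.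
rewrite [`|_ ^+ 2|]ger0_norm; last by rewrite exprn_ge0 // ltW.
by case: (odd k); rewrite /= ?subr0 ?sub0r ?normrN normr1 mul1r.
Qed.

Lemma mass_alt_cvg : mass_alt @ \oo --> (0 : R).
Proof.
have h := @amp_cvg R t b t_gt0 t_le1 b_large.
have h2 : (fun k => 2 * a k) @ \oo --> (0 : R).
  by rewrite -[X in _ --> X](mulr0 2); apply: cvgM => //; exact: cvg_cst.
apply: (squeeze_cvgr _ h h2); apply: nearW => k; exact: mass_alt_bounds.
Qed.

Definition even_levels n n' : seq (nat * nat) :=
  [seq q <- full_levels n' | (n <= q.1)%N && ~~ odd q.1].

Lemma mem_even_levels n n' k j : ((k, j) \in even_levels n n') =
  [&& (n <= k)%N, (k < n')%N, ~~ odd k & haar_index j].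
Proof.
rewrite mem_filter mem_full_levels /=.
by case: (n <= k)%N; case: (odd k); rewrite ?andbF.
Qed.

(** As [s] is 1, the selected cube carries a coefficient equal to the maximum,
which is [kappa] while an even level remains; outside the even levels all
remaining coefficients are smaller than [kappa]. *)
Lemma even_levels_forced p :
  forced coef_alt 1 t (full_levels (b ^ p.+1)) (even_levels (b ^ p.+1) (b ^ p.+2).-1).
Proof.
set n := (b ^ p.+1)%N; set n' := (b ^ p.+2).-1; have b1 := b_ge32 t_gt0 t_le1 b_large.
have n0 : (0 < n)%N by rewrite expn_gt0 (leq_trans _ b1).
have nn : (32 * n <= n'.+1)%N.
  rewrite /n' prednK ?expn_gt0 ?(leq_trans _ b1) //.
  by rewrite [(b ^ _.+1)%N]expnS leq_mul2r b1 orbT.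
have en' : n'.+1 = (b ^ p.+2)%N by rewrite prednK // expn_gt0 (leq_trans _ b1).
rewrite -[even_levels _ _]cat0s; apply: forced_cat; first exact: forced_nil.
  rewrite cat0s /valid cat_uniq all_cat.
  case/andP: (valid_full_levels n) => -> ->; case/andP: (valid_full_levels n') => u v.
  rewrite filter_uniq //= andbT; apply/andP; split.
    apply/hasPn => -[k j]; rewrite mem_even_levels mem_full_levels.
    by move=> /and4P[h _ _ _]; rewrite ltnNge h.
  by apply/allP => q; rewrite mem_filter => /andP[_]; exact: (allP v).
rewrite cats0 => S l i sX sS nS pk.
pose al : R := b%:R ^- p.+1; pose kappa := al + 4 / 3 * al ^+ 2.
have ablk k : (n <= k <= n')%N -> a k = al.
  by move=> h; apply: (amp_block t_gt0 t_le1 b_large); rewrite -en'.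
have tblk k : (n <= k <= n')%N -> turning b k = (k == n').
  by move=> h; rewrite (turning_block t_gt0 t_le1 b_large (p := p.+1)) -en'.
have al0 : 0 < al by rewrite invr_gt0 exprn_gt0 // (b_pos t_gt0 t_le1 b_large).
have al2 : 0 < al ^+ 2 by rewrite exprn_gt0.
have [q qY qS] : exists2 q, q \in even_levels n n' & q \notin S.
  by apply: contrapT => h; apply: nS => q qY; apply: contraT => qS; case: h; exists q.
have [k [j [[hj mx] [lk ch] _ [hi _]]]] := pk.
have big : kappa <= `|residual coef_alt S k j|.
  case: q qY qS => k1 j1; rewrite mem_even_levels => /and4P[h1 h2 h3 h4] qS.
  have h : (n <= k1 <= n')%N by rewrite h1 ltnW.
  have := mx k1 j1 h4; rewrite {1}/residual (negbTE qS) coef_alt_steady; last first.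
    by rewrite tblk // neq_ltn h2.
  by rewrite (negbTE h3) ablk // ger0_norm // addr_ge0 ?mulr_ge0 // ltW.
have [|i' hi' h] := ch l; first by rewrite leqnn.
rewrite mul1r in h; have {big}h : kappa <= `|residual coef_alt S l i'| by exact: le_trans h.
have nS' : (l, i') \notin S.
  apply/negP => iS; move: h; rewrite /residual iS normr0 /kappa; lra.
rewrite /residual (negbTE nS') in h.
have nl : (n <= l)%N.
  rewrite leqNgt; apply/negP => ln; move/negP: nS'; apply; apply: sX.
  by rewrite mem_full_levels ln.
have ln' : (l <= n')%N.
  rewrite leqNgt en'; apply/negP => nl'.
  have := amp_after t_gt0 t_le1 b_large nl'; rewrite exprSr invfM -/al.
  have : b%:R^-1 * al <= 32^-1 * al.
    rewrite ler_pM2r // lef_pV2 ?posrE ?(b_pos t_gt0 t_le1 b_large) //.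
    exact: bR_ge32 t_gt0 t_le1 b_large.
  have /andP[_] := coef_alt_bounds l hi'; move: h; rewrite /kappa; lra.
have lb : (n <= l <= n')%N by rewrite nl.
have ll : l != n'.
  apply/negP => e; have := coef_alt_turning i' (etrans (tblk l lb) e).
  rewrite ablk // => /andP[h1 h2]; move: h; rewrite ler0_norm; last by lra.
  by rewrite /kappa; lra.
rewrite mem_even_levels nl hi andbT ltn_neqAle ll ln' /=; apply/negP => ol.
move: h; rewrite coef_alt_steady ?tblk // ol ablk //.
have h1 : al ^+ 2 <= al.
  rewrite expr2 -(ablk _ lb) ler_piMr ?(amp_le1 t_gt0 t_le1 b_large) // ltW //.
by rewrite ger0_norm /kappa; lra.
Qed.

Lemma full_first_parameter_diverges : exists f : R * R -> R,
  [/\ inL1 f,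
      exists G : nat -> R * R -> R, wga_run 1 t f G
    & forall G : nat -> R * R -> R, wga_run 1 t f G ->
        ~ exists g : R * R -> R, inL1 g /\ cvg_L1 G g].
Proof.
apply: (base_diverges t_gt0 t_le1 (lexx 1) b_large mass_alt_variation mass_alt_cvg
  coef_alt_bounds).
- by rewrite divr_gt0.
- by [].
- by have := bt_ge32 t_gt0 t_le1 b_large; lra.
move=> p; set n := (b ^ p.+1)%N; have b1 := b_ge32 t_gt0 t_le1 b_large.
have n0 : (0 < n)%N by rewrite expn_gt0 (leq_trans _ b1).
have nn : (32 * n <= b ^ p.+2)%N by rewrite [(b ^ _.+1)%N]expnS leq_mul2r b1 orbT.
have al0 : (0 : R) < b%:R ^- p.+1 by rewrite invr_gt0 exprn_gt0 // (b_pos t_gt0 t_le1 b_large).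
pose al : R := b%:R ^- p.+1.
have al2 : 0 < al ^+ 2 by rewrite exprn_gt0.
(* The cells are taken at odd levels, below the even level that contributes there:
   at an even level the Haar functions of indices 2 and 3 are negative on the cell. *)
exists (even_levels n (b ^ p.+2).-1), [seq i.*2.+1 | i <- iota n n], (al + 4 / 3 * al ^+ 2).
split; split.
- by rewrite addr_ge0 ?mulr_ge0 // ltW.
- by rewrite map_inj_uniq ?iota_uniq // => x y; lia.
- rewrite size_map size_iota; apply: (le_trans t_le1).
  have e1 : al * n%:R = 1.
    by rewrite natrX mulVf // expf_neq0 // gt_eqF // (b_pos t_gt0 t_le1 b_large).
  rewrite -[leLHS]e1; apply: ler_wpM2r => //.
  by rewrite lerDl mulr_ge0 // ltW.
- exact: even_levels_forced.
- move=> [k j]; rewrite mem_even_levels => /and4P[h1 h2 h3 h4] /=.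
  have kb : (n <= k < b ^ p.+2)%N by rewrite h1; lia.
  rewrite -/coef_alt coef_alt_steady; last first.
    by rewrite (turning_block t_gt0 t_le1 b_large kb); lia.
  by rewrite (negbTE h3) (amp_block t_gt0 t_le1 b_large kb).
- move=> k [k' j] /mapP[i _ ->]; rewrite mem_even_levels => /and4P[_ _ h _] /= e.
  by move: h; rewrite e /= odd_double.
- move=> k /mapP[i]; rewrite mem_iota => h ->; exists i.*2; first by lia.
  by rewrite mem_even_levels odd_double; apply/and4P; split => //; lia.
Qed.

End FullFirstParameter.

Theorem mainTheorem2 (R : realType) (s t : R)
  (t_gt0 : 0 < t) (t_le_s : t <= s) (s_le1 : s <= 1)
  (hst : s = t \/ s = 1) :
  exists f : R * R -> R,
    [/\ inL1 f,
        exists G : nat -> R * R -> R, wga_run s t f G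
      & forall G : nat -> R * R -> R, wga_run s t f G ->
          ~ exists g : R * R -> R, inL1 g /\ cvg_L1 G g].
Proof.
have t_le1 := le_trans t_le_s s_le1.
have t2 : 0 < t ^+ 2 by rewrite exprn_gt0.
have [b b_large] : exists b : nat, 32 <= b%:R * t ^+ 2.
  exists (Num.bound (32 / t ^+ 2)); rewrite -ler_pdivrMr //.
  by apply/ltW/archi_boundP; rewrite divr_ge0 // ltW.
case: hst => ->; first exact: (equal_parameters_diverge t_gt0 t_le1 b_large).
exact: (full_first_parameter_diverges t_gt0 t_le1 b_large).
Qed.
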